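(* Let $u,v$ be positive integers, and let $m, n$ be positive integers that are divisors of $2^{u}+1$ and $2^{v}-1$, respectively. If $v / \gcd(u,v)$ is odd, then the curve $\mathcal{F}: y^{m} = x^{n} + 1$ over $\overline{\mathbb{F}}_2$ has zero $2$-rank.
   Context: A ''curve'' given by an affine equation over $\overline{\mathbb{F}}_p$ means the nonsingular, projective, irreducible curve whose function field is defined by that equation. The $p$-rank of a curve $\mathcal{X}$ over $\overline{\mathbb{F}}_p$ with Jacobian $J$ is the integer $\gamma$ such that $J[p](\overline{\mathbb{F}}_p)\cong(\mathbb{Z}/p\mathbb{Z})^{\gamma}$; a curve of genus $0$ has $p$-rank $0$. Here $p=2$. *)

(* Defs.v *)
From HB Require Import structures.
From mathcomp Require Import all_boot all_order all_algebra all_field.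
From mathcomp Require Import ring_quotient generic_quotient boolp.
From mathcomp.multinomials Require Export freeg.

Set Implicit Arguments.
Unset Strict Implicit.
Unset Printing Implicit Defensive.

Import GRing.Theory Num.Theory.
Local Open Scope ring_scope.

(* P(x, y), for P : k[X][Y] : the inner variable is X and the outer one is Y. *)
Definition eval2 (k K : fieldType) (iota : {rmorphism k -> K})
    (P : {poly {poly k}}) (x y : K) : K :=
  (map_poly (map_poly iota) P).[y%:P].[x].

(* K is the field of fractions of k[X, Y] / (P), with x and y the classes of X
   and Y: the ideal of relations between x and y is (P), and K = k(x, y).
   Since K is a field, such a K exists only if (P) is prime. *)
Definition is_function_field (k K : fieldType) (iota : {rmorphism k -> K})
    (P : {poly {poly k}}) : Prop :=
  exists x y : K,
    (forall Q : {poly {poly k}},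
       eval2 iota Q x y = 0 <-> exists S : {poly {poly k}}, Q = S * P)
    /\ (forall z : K, exists A B : {poly {poly k}},
          eval2 iota B x y != 0 /\ z = eval2 iota A x y / eval2 iota B x y).

Section CurveOfFunctionField.
Variables (k K : fieldType) (iota : {rmorphism k -> K}).

(* Normalised discrete valuations of K trivial on k.  The junk value v 0 = 0
   (mathematically v 0 = +oo) makes v determined by its values on K^*. *)
Record is_valuation (v : K -> int) : Prop := IsValuation {
  valuation0 : v 0 = 0;
  valuationM : forall f g, f != 0 -> g != 0 -> v (f * g) = v f + v g;
  valuationD : forall f g, f != 0 -> g != 0 -> f + g != 0 ->
                 Num.min (v f) (v g) <= v (f + g);
  valuation_const : forall c, v (iota c) = 0;
  valuation_uniformizer : exists t, v t = 1 }.

(* The points of the nonsingular projective curve over the algebraically closed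
   field k with function field K are the discrete valuations of K / k. *)
Record place := Place { ord :> K -> int; ordP : is_valuation ord }.

HB.instance Definition _ := gen_eqMixin place.
HB.instance Definition _ := gen_choiceMixin place.

(* As k is algebraically closed, all places have degree 1 and the degree of a
   divisor is the sum of its coefficients. *)
Definition degree0 : {pred {freeg place / int}} := fun D => deg D == 0.

Fact degree0_zmod_closed : zmod_closed degree0.
Proof.
split=> [|D E]; first by apply/eqP; rewrite raddf0.
by move=> /eqP D0 /eqP E0; apply/eqP; rewrite raddfB /= D0 E0 subrr.
Qed.
HB.instance Definition _ := GRing.isZmodClosed.Build _ degree0 degree0_zmod_closed.

Record div0 := Div0 { divisor :> {freeg place / int}; _ : divisor \in degree0 }.
HB.instance Definition _ := [isSub for divisor].
HB.instance Definition _ := [Choice of div0 by <:].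
HB.instance Definition _ := [SubChoice_isSubZmodule of div0 by <:].

Definition principal : {pred div0} :=
  fun D => `[< exists f : K, f != 0 /\ forall P : place, coeff P D = ord P f >].

Fact principal_zmod_closed : zmod_closed principal.
Proof.
have ord1 (P : place) : ord P 1 = 0 by rewrite -(rmorph1 iota) (valuation_const (ordP P)).
split=> [|D E].
  by apply/asboolP; exists 1; rewrite oner_neq0; split=> // P; rewrite ord1 coeff0.
move=> /asboolP[f [f0 fD]] /asboolP[g [g0 gE]]; apply/asboolP.
exists (f / g); split; first by rewrite mulf_neq0 ?invr_eq0.
move=> P; rewrite coeffB fD gE.
have gV : ord P g + ord P g^-1 = 0.
  by rewrite -(valuationM (ordP P)) ?invr_eq0 // divff.
rewrite (valuationM (ordP P)) ?invr_eq0 //; congr (_ + _).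
by apply/eqP; rewrite eq_sym -addr_eq0 addrC gV.
Qed.
HB.instance Definition _ :=
  GRing.isZmodClosed.Build _ principal principal_zmod_closed.

(* J(k) = Pic^0 of the curve: degree-0 divisors modulo principal divisors. *)
Definition jacobian : zmodType := Quotient.quot principal.

(* J[p](k) is isomorphic to (Z/pZ)^gamma. *)
Definition has_p_rank (p gamma : nat) : Prop :=
  exists phi : {additive 'rV['F_p]_gamma -> jacobian},
    injective phi /\
    forall c : jacobian, c *+ p = 0 <-> exists v, phi v = c.

End CurveOfFunctionField.

(* y^m = x^n + 1 *)
Definition F_equation (k : fieldType) (m n : nat) : {poly {poly k}} :=
  'X^m - ('X^n + 1)%:P.

(* Main.v *)
Require Import Defs.
From mathcomp Require Import all_boot all_order all_algebra all_field.
From mathcomp Require Import cyclic generic_quotient ring_quotient boolp zify ring.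

Set Implicit Arguments.
Unset Strict Implicit.
Unset Printing Implicit Defensive.

Import Order.TTheory GRing.Theory Num.Theory.
Local Open Scope ring_scope.

(** Let $D$ have degree $0$ with $2D = \mathrm{div}(f)$. If $f = a^2$ then
    $D = \mathrm{div}(a)$ is principal, so it must be shown that a function whose
    order is even at every place is a square. As $K = K^2 \oplus x K^2$, write
    $f = a^2 + b^2 x$ and suppose $b \ne 0$. The logarithmic differential
    $df/f = w\,dx$, with $w = b^2/f$, is then nonzero, holomorphic because the
    orders of $f$ are even, and fixed by the Cartier operator because
    $w = (ab/f)^2 + x w^2$. The curve has no such differential, for the following
    reason.

    Holomorphy makes $w\,dx$ a combination of the forms
    $x^{I-1} y^{J-1} dx / y^{m-1}$ with $I, J \ge 1$ and $mI + nJ < mn$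
    ([regular_form]). The Cartier operator halves exponents modulo $(n, m)$, so
    that a fixed form with a nonzero coefficient at $(I, J)$ also has one at some
    $(I_1, J_1) \equiv (2I, 2J)$ ([fixed_form_coef]). Let $L$ be the least common
    multiple of $u$ and $v$. The hypothesis on $v / \gcd(u, v)$ says that $L$ is an
    odd multiple of $u$, so $2^L \equiv -1$ modulo $m$ while $2^L \equiv 1$ modulo
    $n$. Hence $(I, m - J)$ occurs together with $(I, J)$, which forces
    $2I < n$ for every $I$ that occurs; but then $2I$ occurs as well, and doubling
    cannot go on for ever ([doubling_escapes]).

    Holomorphy has to be extracted from the given places of $K$, and these are
    produced from local expansions. Above each point of the
    projective $x$-line the equation has a solution $x = x_0(t)$, $y = \beta V^{1/m}$ with $V \equiv 1$
    modulo $t$. In characteristic $2$ the root is the limit of the powers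
    $V^{(2^M + 1)/m}$, for suitable $M$ tending to infinity, because
    $V^{2^M} \to 1$. For a polynomial $Q$ outside the ideal of the curve the order in
    $t$ of $Q(x, y)$ at these approximations is eventually constant, and
    the eventual orders define a valuation of $K$ ([limit_valuation]), hence a
    place. Letting the $m$-th roots of unity act on $y$, the bound on the order of
    $w$ passes to each coefficient of its expansion in powers of $y$
    ([coefficient_bound]). *)

(** * Integer-valued valuations *)

(** The value group may be a proper subgroup of the integers, as happens for
    the limits of evaluations constructed below. *)
Record int_valuation (k K : fieldType) (iota : {rmorphism k -> K})
    (v : K -> int) : Prop := IntValuation {
  int_valM : forall f g, f != 0 -> g != 0 -> v (f * g) = v f + v g;
  int_valD : forall f g, f != 0 -> g != 0 -> f + g != 0 ->
               Num.min (v f) (v g) <= v (f + g);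
  int_val_const : forall c, v (iota c) = 0 }.

Lemma valuation_int_valuation (k K : fieldType) (iota : {rmorphism k -> K}) v :
  is_valuation iota v -> int_valuation iota v.
Proof. by case=> _ vM vD vc _; split. Qed.

Section IntValuation.
Variables (k K : fieldType) (iota : {rmorphism k -> K}) (v : K -> int).
Hypothesis vP : int_valuation iota v.

Lemma int_val1 : v 1 = 0.
Proof. by rewrite -(rmorph1 iota) (int_val_const vP). Qed.

Lemma int_valV f : f != 0 -> v f^-1 = - v f.
Proof.
move=> f0; apply/eqP; rewrite -subr_eq0 opprK.
by rewrite -(int_valM vP) ?invr_eq0 // mulVf // int_val1.
Qed.

Lemma int_val_div f g : f != 0 -> g != 0 -> v (f / g) = v f - v g.
Proof. by move=> f0 g0; rewrite (int_valM vP) ?invr_eq0 // int_valV. Qed.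

Lemma int_valX f n : f != 0 -> v (f ^+ n) = v f *+ n.
Proof.
move=> f0; elim: n => [|n IH]; first by rewrite expr0 int_val1.
by rewrite exprS (int_valM vP) ?expf_neq0 // IH mulrS.
Qed.

Lemma int_valN f : v (- f) = v f.
Proof.
have [->|f0] := eqVneq f 0; first by rewrite oppr0.
rewrite -mulN1r (int_valM vP) ?oppr_eq0 ?oner_eq0 //.
by rewrite -(rmorph1 iota) -rmorphN (int_val_const vP) add0r.
Qed.

(** As $v$ is a total function, the order $+\infty$ of $0$ has to be stipulated. *)
Definition val_ge (C : int) (f : K) := (f == 0) || (C <= v f).

Lemma val_ge0 C : val_ge C 0. Proof. by rewrite /val_ge eqxx. Qed.

Lemma val_ge_const c : val_ge 0 (iota c).
Proof. by rewrite /val_ge (int_val_const vP) lexx orbT. Qed.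

Lemma val_ge_refl f : val_ge (v f) f.
Proof. by rewrite /val_ge lexx orbT. Qed.

Lemma val_geW C D f : C <= D -> val_ge D f -> val_ge C f.
Proof. by rewrite /val_ge => CD /orP[->//|/(le_trans CD)->]; rewrite orbT. Qed.

Lemma val_geN C f : val_ge C (- f) = val_ge C f.
Proof. by rewrite /val_ge oppr_eq0 int_valN. Qed.

Lemma val_geD C f g : val_ge C f -> val_ge C g -> val_ge C (f + g).
Proof.
rewrite /val_ge; have [->|f0] /= := eqVneq f 0; first by rewrite add0r.
have [->|g0] /= := eqVneq g 0; first by rewrite addr0 (negbTE f0).
have [//|fg0] /= := eqVneq (f + g) 0 => Cf Cg.
by apply: le_trans (int_valD vP f0 g0 fg0); rewrite le_min Cf.
Qed.

Lemma val_geB C f g : val_ge C f -> val_ge C g -> val_ge C (f - g).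
Proof. by move=> Cf Cg; rewrite val_geD ?val_geN. Qed.

Lemma val_ge_sum (I : Type) (r : seq I) (P : pred I) C (F : I -> K) :
  (forall i, P i -> val_ge C (F i)) -> val_ge C (\sum_(i <- r | P i) F i).
Proof.
move=> CF; apply: (big_ind (val_ge C)) => //; first exact: val_ge0.
by move=> f g; apply: val_geD.
Qed.

Lemma val_geM C D f g : val_ge C f -> val_ge D g -> val_ge (C + D) (f * g).
Proof.
rewrite /val_ge mulf_eq0; have [//|f0] /= := eqVneq f 0.
have [//|g0] /= := eqVneq g 0 => Cf Dg.
by rewrite (int_valM vP) // lerD.
Qed.

Lemma val_geX C f n : val_ge C f -> val_ge (C *+ n) (f ^+ n).
Proof.
move=> Cf; elim: n => [|n IH]; last by rewrite exprS mulrS val_geM.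
by rewrite expr0 /val_ge int_val1 lexx orbT.
Qed.

Lemma val_ge_horner p f : val_ge 0 f -> val_ge 0 (map_poly iota p).[f].
Proof.
move=> f_ge; elim/poly_ind: p => [|p c IH]; first by rewrite rmorph0 horner0 val_ge0.
rewrite rmorphD rmorphM /= map_polyX map_polyC hornerMXaddC.
by rewrite val_geD ?val_ge_const //; have := val_geM IH f_ge; rewrite add0r.
Qed.

(** The isosceles triangle principle: were the order of $f + g$ larger than that
    of $f$, so would be the order of $f = (f + g) - g$. *)
Lemma val_dominant f g : f != 0 -> val_ge (v f + 1) g ->
  f + g != 0 /\ v (f + g) = v f.
Proof.
move=> f0 fg; have fg0 : f + g != 0.
  apply/negP => /eqP fg0; move: fg.
  have -> : g = - f by apply/eqP; rewrite -addr_eq0 addrC fg0.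
  by rewrite val_geN /val_ge (negbTE f0) /=; lia.
split=> //; apply/eqP; rewrite eq_le; apply/andP; split.
  rewrite leNgt; apply/negP => fgf.
  have := @val_geB (v f + 1) (f + g) g _ fg.
  by rewrite addrK /val_ge (negbTE f0) (negbTE fg0) /=; lia.
have := @val_geD (v f) f g (val_ge_refl f) (val_geW _ fg).
by rewrite /val_ge (negbTE fg0) /=; apply; lia.
Qed.

Lemma val_close f g : f != 0 -> val_ge (v f + 1) (g - f) -> g != 0 /\ v g = v f.
Proof. by move=> f0 /(val_dominant f0); rewrite addrC subrK. Qed.

(** A nontrivial valuation is a positive multiple of a normalised one: its
    least positive value divides every value. *)
Lemma normalise_valuation t : t != 0 -> v t != 0 ->
  exists (w : K -> int) (e : int),
    is_valuation iota w /\ forall f, f != 0 -> v f = w f * e.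
Proof.
move=> t0 vt0.
pose pos n := `[< exists2 f, f != 0 & v f = n.+1%:Z >].
have posP f : f != 0 -> 0 < v f -> exists2 n, pos n & v f = n.+1%:Z.
  move=> f0; case vf: (v f) => [[|n]|n] // _.
  by exists n => //; apply/asboolP; exists f.
have ex_pos : exists n, pos n.
  have [vt|vt] := ltP 0 (v t); first by have [n] := posP t t0 vt; exists n.
  have vtV : 0 < v t^-1 by rewrite int_valV // oppr_gt0 lt_neqAle vt0.
  by have [n] := posP t^-1 (invr_neq0 t0) vtV; exists n.
have [d /asboolP[s s0 vs] d_min] := ex_minnP ex_pos.
have vs_gt0 : 0 < v s by rewrite vs.
have vsn0 : v s != 0 by rewrite gt_eqF.
have val_dvd f : f != 0 -> (v s %| v f)%Z.
  move=> f0.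
  have [g g0 vg] : exists2 g, g != 0 & v g = (v f %% v s)%Z.
    rewrite /modz; case: (v f %/ v s)%Z => n.
      exists (f / s ^+ n); first by rewrite mulf_neq0 ?invr_eq0 ?expf_neq0.
      by rewrite int_val_div ?expf_neq0 // int_valX // -mulr_natl natz.
    exists (f * s ^+ n.+1); first by rewrite mulf_neq0 ?expf_neq0.
    by rewrite (int_valM vP) ?expf_neq0 // int_valX // -mulr_natl natz NegzE mulNr opprK.
  have vg_ge : 0 <= v g by rewrite vg modz_ge0.
  have vg_lt : v g < v s by rewrite vg ltz_pmod.
  apply/dvdz_mod0P; rewrite -vg; apply/eqP; apply: contraT => vg0.
  have [|n /d_min dn vgn] := posP g g0; first by rewrite lt_neqAle eq_sym vg0.
  by move: vg_lt; rewrite vgn vs ltz_nat ltnNge ltnS dn.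
pose w f := if f == 0 then 0 else (v f %/ v s)%Z.
have vw f : f != 0 -> v f = w f * v s.
  by move=> f0; rewrite /w (negbTE f0) divzK ?val_dvd.
exists w, (v s); split => //; split.
- by rewrite /w eqxx.
- move=> f g f0 g0; apply: (mulIf vsn0).
  by rewrite mulrDl -!vw ?mulf_neq0 // (int_valM vP).
- move=> f g f0 g0 fg0; have := int_valD vP f0 g0 fg0.
  by rewrite (vw f) // (vw g) // (vw (f + g)) // !ge_min !ler_pM2r.
- move=> c; have [->|c0] := eqVneq c 0; first by rewrite rmorph0 /w eqxx.
  by apply: (mulIf vsn0); rewrite -vw ?fmorph_eq0 // (int_val_const vP) mul0r.
- by exists s; rewrite /w (negbTE s0) divzz vsn0.
Qed.

End IntValuation.

(** * The order at the origin on the field of rational functions *)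

Local Notation "x %:F" := (FracField.tofrac x).

Lemma frac_mul_denom (R : idomainType) (u : {fraction R}) :
  u * (\d_(repr u))%:F = (\n_(repr u))%:F.
Proof.
have d0 := denom_ratioP (repr u).
rewrite -{1}[u]reprK; unlock FracField.tofrac.
rewrite -[LHS]FracField.pi_mul; apply/eqmodP; rewrite /= FracField.equivfE.
by rewrite /FracField.mulf !numden_Ratio ?mulr1 ?oner_neq0 // mulrC.
Qed.

Section OrderAtOrigin.
Variable k : fieldType.
Notation F := {fraction {poly k}}.

Definition const_frac : {rmorphism k -> F} := @FracField.tofrac _ \o polyC.

Lemma mup_modular (a b : {poly k}) : a != 0 -> b != 0 -> a + b != 0 ->
  (minn (mup 0 a) (mup 0 b) <= mup 0 (a + b))%N.
Proof.
move=> a0 b0 ab0; rewrite mup_geq // dvdp_add //.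
  by rewrite -mup_geq // geq_minl.
by rewrite -mup_geq // geq_minr.
Qed.

(** The element of order $1$ is the local parameter of all expansions of the
    curve below; the field is $k(t)$. *)
Lemma exists_valued_field : exists (F : fieldType) (j : {rmorphism k -> F})
    (nu : F -> int), int_valuation j nu /\ exists2 t, t != 0 & nu t = 1.
Proof.
pose vp (a : {poly k}) : int := Posz (mup 0 a).
have frac_ex (u : F) : exists ab : {poly k} * {poly k},
    ab.2 != 0 /\ u = ab.1%:F / ab.2%:F.
  exists (\n_(repr u), \d_(repr u)); split; first exact: denom_ratioP.
  rewrite -(frac_mul_denom u) mulfK // tofrac_eq0; exact: denom_ratioP.
have [nd ndP] := choice frac_ex.
pose nu u := if u == 0 then 0 else vp (nd u).1 - vp (nd u).2.
have vpM a b : a != 0 -> b != 0 -> vp (a * b) = vp a + vp b.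
  by move=> a0 b0; rewrite /vp mupM.
have tofrac_div_eq a b c d : b != 0 -> d != 0 ->
    (a%:F / b%:F == c%:F / d%:F :> F) = (a * d == c * b).
  by move=> b0 d0; rewrite eqr_div ?tofrac_eq0 // -!tofracM tofrac_eq.
have nuE a b : a != 0 -> b != 0 -> nu (a%:F / b%:F) = vp a - vp b.
  move=> a0 b0; set u := _ / _; have u0 : u != 0.
    by rewrite mulf_neq0 ?invr_eq0 ?tofrac_eq0.
  rewrite /nu (negbTE u0); have [d0 uE] := ndP u.
  have n0 : (nd u).1 != 0 by apply: contraNneq u0 => n0; rewrite uE n0 tofrac0 mul0r.
  move/eqP: (uE); rewrite {1}/u tofrac_div_eq // => /eqP /(congr1 vp).
  by rewrite !vpM //; lia.
have fracP (u : F) : u != 0 -> exists a b, [/\ a != 0, b != 0 & u = a%:F / b%:F].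
  move=> u0; have [d0 uE] := ndP u; exists (nd u).1, (nd u).2; split=> //.
  by apply: contraNneq u0 => n0; rewrite uE n0 tofrac0 mul0r.
exists F, const_frac, nu; split; last first.
  exists ('X)%:F; first by rewrite tofrac_eq0 polyX_eq0.
  have := nuE 'X 1 (negbT (polyX_eq0 _)) (oner_neq0 _).
  rewrite tofrac1 divr1 => ->; rewrite /vp (mupNroot (q := 1)) ?root1 //.
  by have := mup_XsubCX 1 0 (0 : k); rewrite eqxx subr0 expr1 => ->.
split.
- move=> f g /fracP[a [b [a0 b0 ->]]] /fracP[c [d [c0 d0 ->]]].
  by rewrite mulf_div -!tofracM !nuE ?mulf_neq0 // !vpM //; ring.
- move=> f g /fracP[a [b [a0 b0 ->]]] /fracP[c [d [c0 d0 ->]]].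
  rewrite addf_div ?tofrac_eq0 // -!tofracM -tofracD => s0.
  have ab0 : a * d + c * b != 0.
    by apply: contraNneq s0 => ->; rewrite tofrac0 mul0r.
  rewrite !nuE ?mulf_neq0 //; have := mup_modular _ _ ab0.
  rewrite !mulf_neq0 // => /(_ isT isT).
  rewrite vpM // /vp !mupM // ge_min geq_min.
  by move: (mup 0 a) (mup 0 b) (mup 0 c) (mup 0 d) (mup 0 (_ + _)) => *; lia.
- move=> c; have [->|c0] := eqVneq c 0; first by rewrite rmorph0 /nu eqxx.
  have cP0 : c%:P != 0 by rewrite polyC_eq0.
  have := nuE c%:P 1 cP0 (oner_neq0 _); rewrite tofrac1 divr1 => ->.
  by rewrite /vp !mupNroot // ?root1 // rootC.
Qed.
End OrderAtOrigin.

(** * The function field of the curve $y^m = x^n + 1$ *)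

Section Evaluation.
Variables (k K : fieldType) (iota : {rmorphism k -> K}) (x y : K).

Definition ev : {rmorphism {poly {poly k}} -> K} :=
  horner_eval x \o horner_eval y%:P \o map_poly (map_poly iota).

Lemma evE Q : eval2 iota Q x y = ev Q. Proof. by []. Qed.

Definition evx : {rmorphism {poly k} -> K} := horner_eval x \o map_poly iota.

Lemma ev_const q : ev q%:P = evx q.
Proof. by rewrite -evE /eval2 map_polyC hornerC. Qed.

Lemma ev_Y : ev 'X = y.
Proof. by rewrite -evE /eval2 map_polyX hornerX hornerC. Qed.

Lemma evx_X : evx 'X = x.
Proof. by rewrite /evx /= map_polyX /horner_eval hornerX. Qed.

Lemma evx_const c : evx c%:P = iota c.
Proof. by rewrite /evx /= map_polyC /horner_eval hornerC. Qed.

Lemma ev_sum d (Q : {poly {poly k}}) : (size Q <= d)%N -> ev Q = \sum_(j < d) evx Q`_j * y ^+ j.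
Proof.
move=> Qd; have {1}-> : Q = \poly_(j < d) Q`_j.
  apply/polyP => j; rewrite coef_poly.
  by case: ltnP => // dj; rewrite nth_default // (leq_trans Qd).
rewrite poly_def rmorph_sum.
by apply: eq_bigr => j _; rewrite -mul_polyC rmorphM rmorphXn ev_const ev_Y.
Qed.

Lemma ev_equation m n : ev (F_equation k m n) = y ^+ m - (x ^+ n + 1).
Proof.
by rewrite rmorphB rmorphXn ev_Y ev_const rmorphD rmorphXn rmorph1 evx_X.
Qed.

Lemma ev_scale q Q : ev (q *: Q) = evx q * ev Q.
Proof. by rewrite -mul_polyC rmorphM ev_const. Qed.

End Evaluation.

Section Curve.
Variables (k K : fieldType) (iota : {rmorphism k -> K}) (m n : nat) (x y : K).
Hypothesis m_gt0 : (0 < m)%N.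
Notation P := (F_equation k m n).
Notation ev := (ev iota x y).
Notation evx := (evx iota x).

Hypothesis ev_eq0 : forall Q, ev Q = 0 <-> exists S, Q = S * P.

Lemma size_equation : size P = m.+1.
Proof. exact: size_XnsubC. Qed.

Lemma equation_monic : P \is monic.
Proof. exact: monicXnsubC. Qed.

Lemma equation_neq0 : P != 0.
Proof. exact: monic_neq0 equation_monic. Qed.

Lemma y_pow : y ^+ m = x ^+ n + 1.
Proof.
apply/eqP; rewrite -subr_eq0 -(ev_equation iota); apply/eqP/ev_eq0.
by exists 1; rewrite mul1r.
Qed.

Lemma ev_inj_small (Q : {poly {poly k}}) : (size Q <= m)%N -> ev Q = 0 -> Q = 0.
Proof.
move=> Qm /ev_eq0[S QE]; apply/eqP; apply: contraLR Qm.
rewrite QE mulf_eq0 negb_or => /andP[S0 _].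
by rewrite size_Mmonic ?equation_monic // size_equation addnS -ltnNge /= -[ltnLHS]add0n ltn_add2r size_poly_gt0.
Qed.

Lemma evx_eq0 q : (evx q == 0) = (q == 0).
Proof.
apply/eqP/eqP => [|->]; last exact: rmorph0.
rewrite -(ev_const _ _ y) => /ev_inj_small q0.
by apply: polyC_inj; rewrite q0 // (leq_trans (size_polyC_leq1 _)).
Qed.

(** A nonzero element of $k[x, y]$ divides a nonzero element of $k[x]$: the
    resultant with the equation of the curve is such a multiple, and vanishes
    only if there is a common factor, which primality of the equation excludes. *)
Lemma norm_relation Q : ev Q != 0 ->
  exists Q' R S, R != 0 /\ Q * Q' = R%:P + S * P.
Proof.
move=> Q0; have [Qs|Qs] := leqP (size Q) 1.
  exists 1, Q`_0, 0; rewrite mulr1 mul0r addr0 -size1_polyC //; split=> //.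
  by apply: contraNneq Q0 => Q00; rewrite (size1_polyC Qs) Q00 rmorph0.
have [|[u v] /= [_ _ uvE]] := resultant_in_ideal (p := P) _ Qs.
  by rewrite size_equation.
exists v, (resultant P Q), (- u); split; last by rewrite uvE; ring.
rewrite resultant_eq0 -leqNgt leqNgt; apply/negP => Gs.
have [/Pdiv.Idomain.dvdpP[[c q] /= c0 cP] /Pdiv.Idomain.dvdpP[[d r] /= d0 dQ]] :=
  (Pdiv.Idomain.dvdp_gcdl P Q, Pdiv.Idomain.dvdp_gcdr P Q).
have : ev q * ev (gcdp P Q) = 0.
  by rewrite -rmorphM -cP ev_scale (ev_eq0 P).2 ?mulr0 //; exists 1; rewrite mul1r.
case/eqP; rewrite mulf_eq0 => /orP[] /eqP /ev_eq0[S SE].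
  have SG : S * gcdp P Q = c%:P.
    apply: (mulIf equation_neq0); rewrite mulrAC -SE -cP mul_polyC //.
  have S0 : S != 0.
    by apply: contraNneq c0 => S0; rewrite -polyC_eq0 -SG S0 mul0r.
  have G0 : gcdp P Q != 0 by rewrite -size_poly_gt0 ltnW.
  have := size_polyC_leq1 c; rewrite -SG size_mul // leqNgt.
  rewrite -size_poly_gt0 in S0; move: Gs S0.
  by move: (size S) (size (gcdp P Q)) => a b; lia.
move: Q0; suff -> : ev Q = 0 by rewrite eqxx.
have : evx d * ev Q = 0.
  by rewrite -ev_scale dQ SE mulrA; apply/ev_eq0; exists (r * S).
by move/eqP; rewrite mulf_eq0 evx_eq0 (negbTE d0) => /eqP.
Qed.

Hypothesis ev_frac : forall z, exists A B, ev B != 0 /\ z = ev A / ev B.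

Lemma common_denominator z : exists (A : {poly {poly k}}) (R : {poly k}),
  [/\ (size A <= m)%N, R != 0 & z * evx R = ev A].
Proof.
have [A [B [B0 ->]]] := ev_frac z.
have [B' [R [S [R0 BB]]]] := norm_relation B0.
have evP S' : ev (S' * P) = 0 by apply/ev_eq0; exists S'.
exists ((A * B') %% P), R; split=> //.
  by rewrite -ltnS -size_equation ltn_modp equation_neq0.
have -> : ev ((A * B') %% P) = ev (A * B').
  rewrite [in RHS](Pdiv.IdomainMonic.divp_eq equation_monic (A * B')).
  by rewrite rmorphD evP add0r.
have -> : evx R = ev B * ev B'.
  by rewrite -rmorphM BB rmorphD evP addr0 ev_const.
by rewrite rmorphM mulrA divfK.
Qed.

(** A root of the denominator that is common to all coefficients of the
    numerator can be divided out, and the degree of the denominator drops. *)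
Lemma reduced_fraction z : exists (A : {poly {poly k}}) (R : {poly k}),
  [/\ (size A <= m)%N, R != 0, z * evx R = ev A &
      forall c, root R c -> exists j, ~~ root A`_j c].
Proof.
have [A [R [Am R0 zE]]] := common_denominator z.
have [d] := ubnP (size R); elim: d => // d IH in A R Am R0 zE *; rewrite ltnS => Rd.
have [[c Rc Ac]|red] := pselect (exists2 c, root R c & forall j, root A`_j c); last first.
  exists A, R; split=> // c Rc; apply: contrapT => Ac; apply: red; exists c => // j.
  by apply/negPn/negP => Aj; apply: Ac; exists j.
have [R1 RE] := factor_theorem _ _ Rc.
pose A1 := \poly_(j < m) (A`_j %/ ('X - c%:P)).
have AE : A = ('X - c%:P)%:P * A1.
  apply/polyP => j; rewrite coefCM coef_poly; case: ltnP => [_|mj].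
    by rewrite mulrC divpK // dvdp_XsubCl.
  by rewrite mulr0 nth_default // (leq_trans Am).
have R10 : R1 != 0 by apply: contraNneq R0 => R10; rewrite RE R10 mul0r.
apply: (IH A1 R1) => //; first exact: size_poly.
  have X0 : evx ('X - c%:P) != 0 by rewrite evx_eq0 polyXsubC_eq0.
  apply: (mulIf X0); rewrite -mulrA -rmorphM -RE zE AE rmorphM ev_const.
  by rewrite mulrC.
by move: Rd; rewrite RE size_mul ?polyXsubC_eq0 // size_XsubC addn2.
Qed.

End Curve.

(** * Limits of valuations *)

Section Sequences.
Variables (k F : fieldType) (j : {rmorphism k -> F}) (nu : F -> int).
Hypothesis nuP : int_valuation j nu.
Implicit Types (s : nat -> F) (e : int).

Definition bounded_seq s := exists C, forall N, val_ge nu C (s N).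
Definition null_seq s := exists C : int, forall N : nat, val_ge nu (N%:Z + C) (s N).
Definition cauchy_seq s := bounded_seq s /\ null_seq (fun N => s N.+1 - s N).
Definition eventual_order s e :=
  exists N0, forall N, (N0 <= N)%N -> s N != 0 /\ nu (s N) = e.

Lemma bounded_const a : bounded_seq (fun=> a).
Proof. by exists (nu a) => _; apply: val_ge_refl. Qed.

Lemma boundedD s1 s2 :
  bounded_seq s1 -> bounded_seq s2 -> bounded_seq (fun N => s1 N + s2 N).
Proof.
move=> [C Cs] [D Ds]; exists (Num.min C D) => N; apply: (val_geD nuP).
  by apply: val_geW (Cs N); rewrite ge_min lexx.
by apply: val_geW (Ds N); rewrite ge_min lexx orbT.
Qed.

Lemma boundedM s1 s2 :
  bounded_seq s1 -> bounded_seq s2 -> bounded_seq (fun N => s1 N * s2 N).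
Proof. by move=> [C Cs] [D Ds]; exists (C + D) => N; apply: (val_geM nuP). Qed.

Lemma null0 : null_seq (fun=> 0).
Proof. by exists 0 => N; apply: val_ge0. Qed.

Lemma nullD s1 s2 : null_seq s1 -> null_seq s2 -> null_seq (fun N => s1 N + s2 N).
Proof.
move=> [C Cs] [D Ds]; exists (Num.min C D) => N; apply: (val_geD nuP).
  by apply: val_geW (Cs N); rewrite lerD2l ge_min lexx.
by apply: val_geW (Ds N); rewrite lerD2l ge_min lexx orbT.
Qed.

Lemma nullM s1 s2 :
  bounded_seq s1 -> null_seq s2 -> null_seq (fun N => s1 N * s2 N).
Proof.
move=> [C Cs] [D Ds]; exists (C + D) => N.
by rewrite addrCA; apply: (val_geM nuP).
Qed.

Lemma eq_null s1 s2 : s1 =1 s2 -> null_seq s1 -> null_seq s2.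
Proof. by move=> e12 [C Cs]; exists C => N; rewrite -e12. Qed.

Lemma bounded_shift s : bounded_seq s -> bounded_seq (fun N => s N.+1).
Proof. by move=> [C Cs]; exists C => N. Qed.

Lemma cauchy_const a : cauchy_seq (fun=> a).
Proof. by split; [apply: bounded_const | apply: eq_null null0 => N; rewrite subrr]. Qed.

Lemma cauchyD s1 s2 :
  cauchy_seq s1 -> cauchy_seq s2 -> cauchy_seq (fun N => s1 N + s2 N).
Proof.
move=> [b1 n1] [b2 n2]; split; first exact: boundedD.
by apply: eq_null (nullD n1 n2) => N; rewrite addrACA opprD.
Qed.

Lemma cauchyM s1 s2 :
  cauchy_seq s1 -> cauchy_seq s2 -> cauchy_seq (fun N => s1 N * s2 N).
Proof.
move=> [b1 n1] [b2 n2]; split; first exact: boundedM.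
apply: eq_null (nullD (nullM (bounded_shift b1) n2) (nullM b2 n1)) => N.
by rewrite /=; ring.
Qed.

Lemma eventual_order_uniq s e1 e2 :
  eventual_order s e1 -> eventual_order s e2 -> e1 = e2.
Proof.
move=> [N1 s1] [N2 s2].
have [_ <-] := s1 _ (leq_maxl N1 N2).
by have [_ <-] := s2 _ (leq_maxr N1 N2).
Qed.

Lemma eventual_order_const a : a != 0 -> eventual_order (fun=> a) (nu a).
Proof. by move=> a0; exists 0. Qed.

Lemma eventual_orderM s1 s2 e1 e2 : eventual_order s1 e1 -> eventual_order s2 e2 ->
  eventual_order (fun N => s1 N * s2 N) (e1 + e2).
Proof.
move=> [N1 o1] [N2 o2]; exists (maxn N1 N2) => N; rewrite geq_max => /andP[NN1 NN2].
have [[s10 <-] [s20 <-]] := (o1 N NN1, o2 N NN2).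
by rewrite mulf_neq0 // (int_valM nuP).
Qed.

Lemma eventual_order_close s1 s2 e : eventual_order s1 e ->
  null_seq (fun N => s2 N - s1 N) -> eventual_order s2 e.
Proof.
move=> [N1 o1] [C Cs]; exists (maxn N1 (absz (e + 1 - C)%R)) => N; rewrite geq_max => /andP[NN1 NN2].
have [s10 s1e] := o1 N NN1.
have [||-> ->] := @val_close _ _ _ _ nuP (s1 N) (s2 N) => //.
by apply: val_geW (Cs N); rewrite s1e; lia.
Qed.

(** The sequence $s'$ bounds $\nu(s_N)$ from above, since $\nu(s_N s'_N)$ is
    eventually $\nu(r)$; once the consecutive differences of $s$ have order larger
    than that bound, the order of $s$ no longer changes. *)
Lemma cauchy_eventual_order s s' r : cauchy_seq s -> bounded_seq s' -> r != 0 ->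
  null_seq (fun N => s N * s' N - r) -> exists e, eventual_order s e.
Proof.
move=> [_ [C dC]] [D sD] r0 sr.
have [N1 o1] := eventual_order_close (eventual_order_const r0) sr.
have bnd N : (N1 <= N)%N -> s N != 0 /\ nu (s N) <= nu r - D.
  move=> NN1; have [] := o1 N NN1; rewrite mulf_eq0 negb_or => /andP[s0 s'0].
  rewrite (int_valM nuP) // => <-; split=> //.
  by have := sD N; rewrite /val_ge (negbTE s'0) /=; lia.
pose N2 := maxn N1 (absz (nu r - D - C + 1)%R).
exists (nu (s N2)), N2; elim=> [|N IH].
  by rewrite leqn0 => /eqP N20; rewrite N20; have [|] := bnd 0%N => //; rewrite -N20 leq_maxl.
rewrite leq_eqVlt => /predU1P[<-|]; first by have [|] := bnd N2; rewrite ?leq_maxl.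
rewrite ltnS => N2N; have [sN0 sNe] := IH N2N.
have [_ sNr] : s N != 0 /\ nu (s N) <= nu r - D by apply: bnd; apply: leq_trans N2N; rewrite leq_maxl.
rewrite -sNe; apply: (val_close nuP) => //.
by apply: val_geW (dC N); move: N2N; rewrite geq_max => /andP[_]; lia.
Qed.

End Sequences.

Section LimitValuation.
Variables (k K F : fieldType) (iota : {rmorphism k -> K}) (j : {rmorphism k -> F}).
Variables (m n : nat) (x y : K) (x0 : F) (y_ : nat -> F) (nu : F -> int).
Hypothesis m_gt0 : (0 < m)%N.
Notation P := (F_equation k m n).
Hypothesis ev_eq0 : forall Q, ev iota x y Q = 0 <-> exists S, Q = S * P.
Hypothesis ev_frac : forall z, exists A B,
  ev iota x y B != 0 /\ z = ev iota x y A / ev iota x y B.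
Hypothesis nuP : int_valuation j nu.
Hypothesis x0_transcendental : forall q, q != 0 -> evx j x0 q != 0.
Hypothesis y_cauchy : cauchy_seq nu y_.
Hypothesis y_root : null_seq nu (fun N => y_ N ^+ m - (x0 ^+ n + 1)).

Let evs Q N := ev j x0 (y_ N) Q.

Lemma evs_cauchy Q : cauchy_seq nu (evs Q).
Proof.
elim/poly_ind: Q => [|Q q IH].
  have -> : evs 0 = fun=> 0 by apply/funext => N; rewrite /evs rmorph0.
  exact: cauchy_const.
have -> : evs (Q * 'X + q%:P) = fun N => evs Q N * y_ N + evx j x0 q.
  by apply/funext => N; rewrite /evs rmorphD rmorphM ev_const ev_Y.
apply: (cauchyD nuP); last exact: cauchy_const.
exact: (cauchyM nuP IH y_cauchy).
Qed.

Lemma evs_ideal_null S : null_seq nu (evs (S * P)).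
Proof.
have [bS _] := evs_cauchy S; apply: eq_null (nullM nuP bS y_root) => N.
by rewrite /evs rmorphM ev_equation.
Qed.

Lemma evs_eventual_order Q : ev iota x y Q != 0 -> exists e, eventual_order nu (evs Q) e.
Proof.
move=> /(norm_relation m_gt0 ev_eq0)[Q' [R [S [R0 QE]]]].
have [bQ' _] := evs_cauchy Q'.
apply: (cauchy_eventual_order nuP (evs_cauchy Q) bQ' (x0_transcendental R0)).
apply: eq_null (evs_ideal_null S) => N.
by rewrite /evs -rmorphM QE rmorphD ev_const addrC addKr.
Qed.

(** Evaluation at the approximate roots yields a valuation of the function
    field: relations hold only up to null sequences, which do not affect the
    eventual order. *)
Lemma limit_valuation : exists v : K -> int, int_valuation iota v /\
  forall Q, ev iota x y Q != 0 -> eventual_order nu (evs Q) (v (ev iota x y Q)).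
Proof.
have evs_eq Q Q' e : ev iota x y Q = ev iota x y Q' ->
    eventual_order nu (evs Q) e -> eventual_order nu (evs Q') e.
  move=> QQ' Qe; have /ev_eq0[S SE] : ev iota x y (Q' - Q) = 0.
    by rewrite rmorphB QQ' subrr.
  apply: (eventual_order_close nuP Qe); apply: eq_null (evs_ideal_null S) => N.
  by rewrite -SE /evs rmorphB.
have evsM Q Q' e e' : eventual_order nu (evs Q) e ->
    eventual_order nu (evs Q') e' -> eventual_order nu (evs (Q * Q')) (e + e').
  move=> Qe Qe'; have := eventual_orderM nuP Qe Qe'.
  by congr eventual_order; apply/funext => N; rewrite /evs rmorphM.
pose Phi z e := z != 0 -> forall A B a b, z * ev iota x y B = ev iota x y A ->
  eventual_order nu (evs A) a -> eventual_order nu (evs B) b -> e = a - b.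
have fracP z : z != 0 -> exists A B a b, [/\ z * ev iota x y B = ev iota x y A,
    ev iota x y B != 0, ev iota x y A != 0,
    eventual_order nu (evs A) a & eventual_order nu (evs B) b].
  move=> z0; have [A [B [B0 zE]]] := ev_frac z; exists A, B.
  have zB : z * ev iota x y B = ev iota x y A by rewrite zE divfK.
  have A0 : ev iota x y A != 0 by rewrite -zB mulf_neq0.
  have [a Aa] := evs_eventual_order A0; have [b Bb] := evs_eventual_order B0.
  by exists a, b.
have vex z : exists e, (z = 0 -> e = 0) /\ Phi z e.
  have [->|z0] := eqVneq z 0; first by exists 0; split=> // /eqP.
  have [A [B [a [b [zB B0 A0 Aa Bb]]]]] := fracP z z0.
  exists (a - b); split=> [/eqP|_ A' B' a' b' zB' Aa' Bb']; first by rewrite (negbTE z0).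
  have : ev iota x y (A * B') = ev iota x y (A' * B).
    by rewrite !rmorphM -zB -zB'; ring.
  move/evs_eq => /(_ _ (evsM _ _ _ _ Aa Bb')) /eventual_order_uniq.
  by move=> /(_ _ (evsM _ _ _ _ Aa' Bb)); lia.
have [v v0Phi] := choice vex; have vPhi z := (v0Phi z).2.
have vE Q e : ev iota x y Q != 0 -> eventual_order nu (evs Q) e -> v (ev iota x y Q) = e.
  move=> Q0 Qe; rewrite -[RHS]subr0; apply: (vPhi _ Q0 Q 1) => //.
    by rewrite rmorph1 mulr1.
  have -> : evs 1 = fun=> 1 by apply/funext => N; rewrite /evs rmorph1.
  by rewrite -(int_val1 nuP); apply: eventual_order_const; rewrite oner_neq0.
exists v; split; last first.
  by move=> Q Q0; have [e Qe] := evs_eventual_order Q0; rewrite (vE Q e).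
have vD' f g : f != 0 -> g != 0 -> f + g != 0 -> v f <= v g -> v f <= v (f + g).
  move=> f0 g0 fg0.
  have [A [B [a [b [fB B0 A0 Aa Bb]]]]] := fracP f f0.
  have [C [D [c [d [gD D0 C0 Cc Dd]]]]] := fracP g g0.
  have fgE : (f + g) * ev iota x y (B * D) = ev iota x y (A * D + C * B).
    by rewrite rmorphD !rmorphM -fB -gD; ring.
  have S0 : ev iota x y (A * D + C * B) != 0 by rewrite -fgE rmorphM !mulf_neq0.
  have [e Se] := evs_eventual_order S0.
  rewrite (vPhi _ f0 _ _ _ _ fB Aa Bb) (vPhi _ g0 _ _ _ _ gD Cc Dd).
  rewrite (vPhi _ fg0 _ _ _ _ fgE Se (evsM _ _ _ _ Bb Dd)) => abcd.
  have [N1 o1] := evsM _ _ _ _ Aa Dd; have [N2 o2] := evsM _ _ _ _ Cc Bb.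
  have [N3 o3] := Se; pose N := maxn (maxn N1 N2) N3.
  have [|AD0 AD] := o1 N; first by rewrite /N !leq_max leqnn.
  have [|CB0 CB] := o2 N; first by rewrite /N !leq_max leqnn orbT.
  have [|] := o3 N; first exact: leq_maxr.
  rewrite /evs rmorphD => SS0 SSe.
  have := int_valD nuP AD0 CB0 SS0; rewrite SSe AD CB; move: abcd; clear; lia.
split.
- move=> f g f0 g0.
  have [A [B [a [b [fB B0 A0 Aa Bb]]]]] := fracP f f0.
  have [C [D [c [d [gD D0 C0 Cc Dd]]]]] := fracP g g0.
  have fgE : (f * g) * ev iota x y (B * D) = ev iota x y (A * C).
    by rewrite !rmorphM -fB -gD; ring.
  rewrite (vPhi _ f0 _ _ _ _ fB Aa Bb) (vPhi _ g0 _ _ _ _ gD Cc Dd).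
  rewrite (vPhi _ (mulf_neq0 f0 g0) _ _ _ _ fgE (evsM _ _ _ _ Aa Cc) (evsM _ _ _ _ Bb Dd)).
  by ring.
- move=> f g f0 g0 fg0; rewrite ge_min.
  have [/vD'->//|/ltW gf] := leP (v f) (v g).
  by rewrite [f + g]addrC vD' ?orbT // addrC.
- move=> c; have [->|c0] := eqVneq c 0.
    by rewrite rmorph0; apply: (v0Phi 0).1.
  have cE : iota c = ev iota x y c%:P%:P by rewrite ev_const evx_const.
  rewrite cE; apply: vE; first by rewrite -cE fmorph_eq0.
  have -> : evs c%:P%:P = fun=> j c.
    by apply/funext => N; rewrite /evs ev_const evx_const.
  by rewrite -(int_val_const nuP c); apply: eventual_order_const; rewrite fmorph_eq0.
Qed.
End LimitValuation.

(** * Characteristic two and roots of unity *)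

Lemma dvdn_odd_power_add1 a q : odd q -> (a + 1 %| a ^ q + 1)%N.
Proof.
move=> q_odd; have -> : q = (q./2.*2 + 1)%N.
  by rewrite -[LHS]odd_double_half q_odd addnC.
case: a => [|a]; first by rewrite add0n dvd1n.
elim: q./2 => [|r IH]; first by rewrite double0 add0n expn1.
have -> : (a.+1 ^ (r.+1.*2 + 1) + 1 =
    a.+1 ^ 2 * (a.+1 ^ (r.*2 + 1) + 1) - (a.+1 + 1) * a)%N.
  rewrite doubleS !addSn !expnS expn0 muln1; move: (a.+1 ^ _)%N => b.
  by nia.
by apply: dvdn_sub; [apply: dvdn_mull | apply: dvdn_mulr].
Qed.

Lemma odd_dvd_pow2_add1 u m : (0 < u)%N -> (m %| 2 ^ u + 1)%N -> odd m.
Proof. by case: u => // u _ /dvdn_odd; apply; rewrite oddD oddX. Qed.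

Lemma sqrrD_pchar2 (R : comNzRingType) (a b : R) :
  2%N \in [pchar R] -> (a + b) ^+ 2 = a ^+ 2 + b ^+ 2.
Proof. by move=> R2; rewrite exprDn_pchar // pnatE. Qed.

Lemma expr_pow2B_pchar2 (R : comNzRingType) (a b : R) M :
  2%N \in [pchar R] -> (a - b) ^+ (2 ^ M) = a ^+ (2 ^ M) - b ^+ (2 ^ M).
Proof. by move=> R2; rewrite !oppr_pchar2 // exprDn_pchar // pnatX pnatE // R2. Qed.

Lemma odd_natr_pchar2 (R : nzRingType) m : 2%N \in [pchar R] -> odd m -> m%:R = 1 :> R.
Proof.
move=> R2 m_odd; rewrite -(odd_double_half m) m_odd -muln2 natrD natrM.
by rewrite (pcharf0 R2) mulr0 addr0.
Qed.

Lemma exists_nth_root (k : closedFieldType) m (c : k) :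
  (0 < m)%N -> exists r, r ^+ m = c.
Proof.
move=> m_gt0; have /closed_rootP[r] : size ('X^m - c%:P) != 1%N.
  by rewrite size_XnsubC // eqSS -lt0n.
by rewrite rootE !hornerE subr_eq0 => /eqP rE; exists r.
Qed.

Lemma exists_prim_root (k : closedFieldType) m :
  (0 < m)%N -> m%:R != 0 :> k -> exists z : k, m.-primitive_root z.
Proof.
move=> m_gt0 mk0; have [rs] := closed_field_poly_normal ('X^m - 1 : {poly k}).
have -> : lead_coef ('X^m - 1 : {poly k}) = 1 by apply/eqP/monic_Xn_sub_1.
rewrite scale1r => XE; have rs_roots : all m.-unity_root rs.
  by apply/allP => z zrs; rewrite /root_of_unity XE root_prod_XsubC.
have rs_uniq : uniq rs by rewrite -separable_prod_XsubC -XE separable_Xn_sub_1.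
have rs_size : (m <= size rs)%N.
  by have := size_Xn_sub_1 k m_gt0; rewrite XE size_prod_XsubC => -[->].
by have /hasP[z _] := has_prim_root m_gt0 rs_roots rs_uniq rs_size; exists z.
Qed.

Lemma sum_prim_root (k : fieldType) m (z : k) a : m.-primitive_root z ->
  \sum_(i < m) z ^+ (i * a) = if (m %| a)%N then m%:R else 0.
Proof.
move=> zm; have -> : \sum_(i < m) z ^+ (i * a) = \sum_(i < m) (z ^+ a) ^+ i.
  by apply: eq_bigr => i _; rewrite -exprM mulnC.
rewrite (prim_order_dvd zm); case: eqVneq => [->|za].
  under eq_bigr => i _ do rewrite expr1n.
  by rewrite sumr_const card_ord.
have za1 : z ^+ a - 1 != 0 by rewrite subr_eq0.
by apply: (mulfI za1); rewrite mulr0 -subrX1 -exprM mulnC exprM (prim_expr_order zm) expr1n subrr.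
Qed.

(** * Local expansions of the curve *)

Section ApproximateRoots.
Variables (k F : fieldType) (j : {rmorphism k -> F}) (nu : F -> int) (u m : nat).
Hypothesis nuP : int_valuation j nu.
Hypothesis F2 : 2%N \in [pchar F].
Hypotheses (u_gt0 : (0 < u)%N) (m_dvd : (m %| 2 ^ u + 1)%N).
Variables (beta V : F).
Hypotheses (beta0 : beta != 0) (V1 : val_ge nu 1 (V - 1)).

Let m_odd : odd m := odd_dvd_pow2_add1 u_gt0 m_dvd.
Let m_gt0 : (0 < m)%N := odd_gt0 m_odd.

(** As $m$ divides $2^M + 1$ for $M = u(2N+1)$, the exponent $(2^M+1)/m$ is
    $2$-adically close to $1/m$. *)
Definition root_prec N := (u * (2 * N + 1))%N.
Definition root_exp N := ((2 ^ root_prec N + 1) %/ m)%N.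
Definition approx_root N := beta * V ^+ root_exp N.

Lemma root_expE N : (root_exp N * m = 2 ^ root_prec N + 1)%N.
Proof.
rewrite divnK // (dvdn_trans m_dvd) // /root_prec expnM dvdn_odd_power_add1 //.
by rewrite addn1 /= mul2n odd_double.
Qed.

Lemma root_prec_ge N : (N <= 2 ^ root_prec N)%N.
Proof.
apply: leq_trans (ltnW (ltn_expl N (ltnSn 1))) _.
by rewrite leq_exp2l // /root_prec; nia.
Qed.

Lemma one_unit : V != 0 /\ nu V = 0.
Proof.
have [||-> ->] := @val_close _ _ _ _ nuP 1 V; rewrite ?oner_neq0 ?(int_val1 nuP) //.
Qed.

Lemma one_unit_pow q : val_ge nu 1 (V ^+ q - 1).
Proof.
have [V0 nuV] := one_unit; elim: q => [|q IH]; first by rewrite subrr val_ge0.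
have -> : V ^+ q.+1 - 1 = V * (V ^+ q - 1) + (V - 1) by rewrite exprS; ring.
apply: (val_geD nuP) => //; rewrite -[1]add0r -nuV.
by rewrite (val_geM nuP) ?val_ge_refl.
Qed.

Lemma one_unit_pow2 q M : val_ge nu (2 ^ M)%:Z (V ^+ (q * 2 ^ M) - 1).
Proof.
have := val_geX nuP (2 ^ M) (one_unit_pow q).
by rewrite expr_pow2B_pchar2 // expr1n -exprM natz.
Qed.

Lemma approx_root_neq0 N : approx_root N != 0 /\ nu (approx_root N) = nu beta.
Proof.
have [V0 nuV] := one_unit; split; first by rewrite mulf_neq0 ?expf_neq0.
by rewrite (int_valM nuP) ?expf_neq0 // (int_valX nuP) // nuV mul0rn addr0.
Qed.

Lemma approx_root_bounded : bounded_seq nu approx_root.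
Proof. by exists (nu beta) => N; have [_ <-] := approx_root_neq0 N; apply: val_ge_refl. Qed.

Lemma approx_root_cauchy : cauchy_seq nu approx_root.
Proof.
split; first exact: approx_root_bounded.
have /choice[d dE] N : exists d, root_exp N.+1 = (root_exp N + d * 2 ^ root_prec N)%N.
  have EN := root_expE N; have EN1 := root_expE N.+1.
  have lt_exp : (2 ^ root_prec N <= 2 ^ root_prec N.+1)%N.
    by rewrite leq_exp2l // /root_prec; nia.
  have le_e : (root_exp N <= root_exp N.+1)%N by rewrite leq_div2r // leq_add2r.
  have : (2 ^ root_prec N %| (root_exp N.+1 - root_exp N) * m)%N.
    rewrite mulnBl EN EN1 subnDr dvdn_sub ?dvdn_exp2l //.
    by rewrite /root_prec; nia.
  rewrite Gauss_dvdl ?coprimeXl ?coprime2n // => /dvdnP[d dE].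
  by exists d; rewrite -dE subnKC.
have [C Cb] := approx_root_bounded; exists C => N.
have -> : approx_root N.+1 - approx_root N =
    approx_root N * (V ^+ (d N * 2 ^ root_prec N) - 1).
  by rewrite /approx_root dE exprD; ring.
rewrite addrC (val_geM nuP) //; apply: val_geW (one_unit_pow2 _ _).
by rewrite lez_nat root_prec_ge.
Qed.

Lemma approx_root_null : null_seq nu (fun N => approx_root N ^+ m - beta ^+ m * V).
Proof.
have [V0 nuV] := one_unit.
exists (nu (beta ^+ m * V)) => N.
have -> : approx_root N ^+ m - beta ^+ m * V =
    (V ^+ (1 * 2 ^ root_prec N) - 1) * (beta ^+ m * V).
  by rewrite /approx_root exprMn -exprM root_expE exprD mul1n; ring.
rewrite (val_geM nuP) ?val_ge_refl //; apply: val_geW (one_unit_pow2 _ _).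
by rewrite lez_nat root_prec_ge.
Qed.

End ApproximateRoots.

(** * Holomorphy of the logarithmic differential *)

Definition even_at_places (k K : fieldType) (iota : {rmorphism k -> K}) (f : K) :=
  forall w, is_valuation iota w -> (2 %| w f)%Z.

Lemma even_int_valuation (k K : fieldType) (iota : {rmorphism k -> K}) f v t :
  even_at_places iota f -> int_valuation iota v -> t != 0 -> v t != 0 ->
  f != 0 -> (2 %| v f)%Z.
Proof.
move=> f_even vP t0 vt0 f0; have [w [e [wP ve]]] := normalise_valuation vP t0 vt0.
by rewrite ve // dvdz_mulr // f_even.
Qed.

(** In the decomposition $f = a^2 + b^2 \xi$ the two terms have orders of
    different parities, so an even order is that of $a^2$. *)
Lemma log_pole (k K : fieldType) (iota : {rmorphism k -> K}) v f a b xi :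
  int_valuation iota v -> f = a ^+ 2 + b ^+ 2 * xi -> f != 0 -> b != 0 -> xi != 0 ->
  (2 %| v f)%Z -> ~~ (2 %| v xi)%Z -> 0 < v (b ^+ 2 / f) + v xi.
Proof.
move=> vP fE f0 b0 xi0 f_even xi_odd.
have b20 : b ^+ 2 != 0 by rewrite expf_neq0.
rewrite (int_val_div vP) // (int_valX vP) //.
have vb : v (b ^+ 2 * xi) = v b *+ 2 + v xi by rewrite (int_valM vP) // (int_valX vP).
have [a0|a0] := eqVneq a 0.
  by move: f_even; rewrite fE a0 expr0n add0r vb; lia.
have va : v (a ^+ 2) = v a *+ 2 by rewrite (int_valX vP).
have [ab|ba] := leP (v (a ^+ 2) + 1) (v (b ^+ 2 * xi)).
  have [||_] := @val_dominant _ _ _ _ vP (a ^+ 2) (b ^+ 2 * xi).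
  - by rewrite expf_neq0.
  - by rewrite /val_ge ab orbT.
  - by move: ab; rewrite -fE vb va => ? ->; lia.
have [||_] := @val_dominant _ _ _ _ vP (b ^+ 2 * xi) (a ^+ 2).
- by rewrite mulf_neq0.
- by rewrite /val_ge; apply/orP; right; move: ba; rewrite va vb; lia.
by rewrite addrC -fE vb => vf; move: f_even; rewrite vf; lia.
Qed.

Section LocalBound.
Variables (k : closedFieldType) (K F : fieldType).
Variables (iota : {rmorphism k -> K}) (j : {rmorphism k -> F}).
Variables (u m n : nat) (x y : K) (nu : F -> int).
Hypothesis k2 : 2%N \in [pchar k].
Hypotheses (u_gt0 : (0 < u)%N) (m_dvd : (m %| 2 ^ u + 1)%N) (n_gt0 : (0 < n)%N).
Notation P := (F_equation k m n).
Notation ev := (ev iota x y).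
Hypothesis ev_eq0 : forall Q, ev Q = 0 <-> exists S, Q = S * P.
Hypothesis ev_frac : forall z, exists A B, ev B != 0 /\ z = ev A / ev B.
Hypothesis nuP : int_valuation j nu.

Let m_odd : odd m := odd_dvd_pow2_add1 u_gt0 m_dvd.
Let m_gt0 : (0 < m)%N := odd_gt0 m_odd.
Let F2 : 2%N \in [pchar F] := rmorph_pchar j k2.

Lemma y_neq0 : y != 0.
Proof.
have : evx iota x ('X^n + 1) != 0.
  rewrite (evx_eq0 m_gt0 ev_eq0) -size_poly_gt0 size_XnaddC //.
rewrite rmorphD rmorphXn rmorph1 evx_X -(y_pow ev_eq0).
by rewrite expf_eq0 m_gt0.
Qed.

Section Expansion.
Variables (c : k) (x0 beta V : F).
Hypotheses (x0_odd : ~~ (2 %| nu (x0 - j c))%Z) (beta0 : beta != 0).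
Hypotheses (V1 : val_ge nu 1 (V - 1)) (x0_pow : x0 ^+ n + 1 = beta ^+ m * V).

(** An algebraic $x_0$ would be a constant, as $k$ is algebraically closed, and
    then $x_0 - c$ would have order $0$, which is even. *)
Lemma local_transcendental q : q != 0 -> evx j x0 q != 0.
Proof.
have x0c d : x0 != j d.
  apply: contraNneq x0_odd => ->.
  by rewrite -rmorphB (int_val_const nuP).
move=> q0; have [rs ->] := closed_field_poly_normal q.
rewrite -mul_polyC rmorphM evx_const mulf_neq0 //.
  by rewrite fmorph_eq0 lead_coef_eq0.
rewrite rmorph_prod prodf_seq_neq0; apply/allP => d _; apply/implyP => _.
by rewrite rmorphB evx_X evx_const subr_eq0.
Qed.

(** The place of the curve above the expansion $x = x_0$, $y = \beta V^{1/m}$. *)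
Lemma local_valuation : exists v : K -> int, [/\ int_valuation iota v, v y = nu beta,
    forall q, q != 0 -> v (evx iota x q) = nu (evx j x0 q) &
    forall Q, ev Q != 0 ->
      eventual_order nu (fun N => eval2 j Q x0 (approx_root u m beta V N)) (v (ev Q))].
Proof.
have y_cauchy := approx_root_cauchy nuP F2 u_gt0 m_dvd beta0 V1.
have := approx_root_null nuP F2 u_gt0 m_dvd beta0 V1; rewrite -x0_pow => y_root.
have [v [vP v_lim]] := limit_valuation m_gt0 ev_eq0 ev_frac nuP
  local_transcendental y_cauchy y_root.
exists v; split=> //.
  have := v_lim 'X; rewrite ev_Y => /(_ y_neq0) [N0 /(_ N0 (leqnn _))].
  rewrite ev_Y => -[_ <-].
  by have [_ ->] := approx_root_neq0 u m nuP beta0 V1 N0.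
move=> q q0; have := v_lim q%:P; rewrite ev_const (evx_eq0 m_gt0 ev_eq0).
by move=> /(_ q0) [N0 /(_ N0 (leqnn _))] [_ <-]; rewrite ev_const.
Qed.

(** The decomposition $f = (a + b \sqrt c)^2 + b^2 (x - c)$ adapts $f$ to the place,
    at which $x - c$ has odd order. *)
Lemma log_form_order f a b A R : even_at_places iota f ->
    f = a ^+ 2 + b ^+ 2 * x -> f != 0 -> b != 0 -> R != 0 ->
    b ^+ 2 / f * y ^+ m.-1 * evx iota x R = ev A ->
  exists N0, forall N, (N0 <= N)%N ->
    val_ge nu (nu (evx j x0 R) - nu (x0 - j c) + nu beta *+ m.-1 + 1)
      (eval2 j A x0 (approx_root u m beta V N)).
Proof.
move=> f_even fE f0 b0 R0 wE.
have [v [vP vy vx v_lim]] := local_valuation.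
have Xc0 : 'X - c%:P != 0 by rewrite polyXsubC_eq0.
have xi0 : x - iota c != 0.
  by rewrite -(evx_X iota x) -(evx_const iota x) -rmorphB (evx_eq0 m_gt0 ev_eq0).
have vxi : v (x - iota c) = nu (x0 - j c).
  by have := vx _ Xc0; rewrite !rmorphB !evx_X !evx_const.
have [s sE] := exists_nth_root c (isT : 0 < 2)%N.
have fE' : f = (a + b * iota s) ^+ 2 + b ^+ 2 * (x - iota c).
  rewrite sqrrD_pchar2 ?(rmorph_pchar iota) // exprMn -rmorphXn sE fE.
  by rewrite mulrBr addrACA subrr addr0.
have v_even : (2 %| v f)%Z.
  apply: (even_int_valuation f_even vP xi0) => //.
  by rewrite vxi; apply: contraNneq x0_odd => ->.
have := log_pole vP fE' f0 b0 xi0 v_even; rewrite vxi => /(_ x0_odd) w_gt.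
have w0 : b ^+ 2 / f != 0 by rewrite mulf_neq0 ?invr_eq0 // expf_neq0.
have R0' : evx iota x R != 0 by rewrite (evx_eq0 m_gt0 ev_eq0).
have A0 : ev A != 0 by rewrite -wE mulf_neq0 // mulf_neq0 // expf_neq0 // y_neq0.
have vA : v (ev A) = v (b ^+ 2 / f) + nu beta *+ m.-1 + nu (evx j x0 R).
  rewrite -wE (int_valM vP _ R0') ?(mulf_neq0 w0) ?expf_neq0 ?y_neq0 //.
  rewrite (int_valM vP w0) ?expf_neq0 ?y_neq0 //.
  by rewrite (int_valX vP) ?y_neq0 // vy vx.
have [N0 A_ord] := v_lim A A0; exists N0 => N /A_ord[_ AN].
rewrite /val_ge AN vA; apply/orP; right.
set r := nu _; set o := nu _ in w_gt *; set s2 := _ *+ _; set w := v _ in w_gt *.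
have -> : w + s2 + r = r - o + s2 + (w + o) by ring.
by rewrite lerD2l -gtz0_ge1.
Qed.

End Expansion.

(** Replacing $y$ by $z^i y$, for $z$ a primitive $m$-th root of unity, gives
    the expansions at the conjugate places; a character sum then isolates the
    terms of each degree in $y$. *)
Lemma coefficient_bound c x0 beta V f a b (A : {poly {poly k}}) R l :
    ~~ (2 %| nu (x0 - j c))%Z -> beta != 0 -> val_ge nu 1 (V - 1) ->
    x0 ^+ n + 1 = beta ^+ m * V ->
    even_at_places iota f -> f = a ^+ 2 + b ^+ 2 * x -> f != 0 -> b != 0 ->
    R != 0 -> (size A <= m)%N -> b ^+ 2 / f * y ^+ m.-1 * evx iota x R = ev A ->
    (l < m)%N -> A`_l != 0 ->
  nu (evx j x0 R) - nu (x0 - j c) + nu beta *+ m.-1 + 1 <=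
    nu (evx j x0 A`_l) + nu beta *+ l.
Proof.
move=> x0_odd beta0 V1 x0_pow f_even fE f0 b0 R0 Am wE lm Al0.
set kappa := (X in X <= _).
have m1 : m%:R = 1 :> k by rewrite odd_natr_pchar2.
have [z zm] : exists z : k, m.-primitive_root z.
  by apply: exists_prim_root; rewrite ?m1 ?oner_neq0.
have z0 i : j (z ^+ i) != 0 by rewrite fmorph_eq0 expf_neq0 // (prim_root_eq0 zm) -lt0n.
pose Y i := approx_root u m (j (z ^+ i) * beta) V.
have /choice[N0 N0P] i : exists N0, forall N, (N0 <= N)%N ->
    val_ge nu kappa (eval2 j A x0 (Y i N)).
  have bz0 : j (z ^+ i) * beta != 0 by rewrite mulf_neq0.
  have x0_pow' : x0 ^+ n + 1 = (j (z ^+ i) * beta) ^+ m * V.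
    by rewrite exprMn -rmorphXn exprAC (prim_expr_order zm) expr1n rmorph1 mul1r.
  have := log_form_order x0_odd bz0 V1 x0_pow' f_even fE f0 b0 R0 wE.
  by rewrite (int_valM nuP) // (int_val_const nuP) add0r.
pose N := \max_(i < m) N0 i; pose y1 := approx_root u m beta V N.
have YE i : Y i N = j (z ^+ i) * y1 by rewrite /Y /approx_root mulrA.
(* The factor $z^{i(m-l)}$ is $z^{-il}$, with a natural exponent. *)
have kappa_sum : val_ge nu kappa
    (\sum_(i < m) j (z ^+ (i * (m - l))) * eval2 j A x0 (Y i N)).
  apply: (val_ge_sum nuP) => i _; rewrite -[kappa]add0r (val_geM nuP) ?(val_ge_const nuP) //.
  by apply: N0P; apply: (leq_bigmax (F := fun i : 'I_m => N0 i)).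
suff sumE : \sum_(i < m) j (z ^+ (i * (m - l))) * eval2 j A x0 (Y i N) =
    evx j x0 A`_l * y1 ^+ l.
  have Ax0 : evx j x0 A`_l != 0 by apply: local_transcendental x0_odd _ Al0.
  have [y10 y1e] := approx_root_neq0 u m nuP beta0 V1 N.
  move: kappa_sum; rewrite sumE /val_ge mulf_eq0 expf_eq0 (negbTE Ax0) (negbTE y10) andbF /=.
  by rewrite (int_valM nuP) ?expf_neq0 // (int_valX nuP) // y1e.
pose T i r := evx j x0 A`_r * y1 ^+ r * j (z ^+ (i * (m - l + r))).
transitivity (\sum_(i < m) \sum_(r < m) T i r).
  apply: eq_bigr => i _; rewrite evE (ev_sum _ _ _ Am) mulr_sumr; apply: eq_bigr => r _.
  by rewrite YE exprMn -rmorphXn -exprM /T mulnDr exprD rmorphM; ring.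
have sumT r : \sum_(i < m) T i r =
    evx j x0 A`_r * y1 ^+ r * j (if (m %| m - l + r)%N then m%:R else 0).
  by rewrite -mulr_sumr -rmorph_sum (sum_prim_root _ zm).
have other_terms r : r != Ordinal lm -> \sum_(i < m) T i r = 0.
  move=> rl; rewrite sumT ifF ?rmorph0 ?mulr0 //.
  apply/negP => /dvdnP[q qE]; move/eqP: rl; apply; apply: val_inj => /=.
  by move: lm (ltn_ord r) qE; clear; case: q => [|[|q]]; nia.
transitivity (\sum_(r < m) \sum_(i < m) T i r); first exact: exchange_big.
rewrite (bigD1 (Ordinal lm)) //= (eq_bigr _ other_terms) big1_eq addr0.
by rewrite sumT subnK 1?ltnW // dvdnn m1 rmorph1 mulr1.
Qed.

End LocalBound.

Section OrdersOfPolynomials.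
Variables (k F : fieldType) (j : {rmorphism k -> F}) (nu : F -> int) (x0 : F).
Hypothesis nuP : int_valuation j nu.

Lemma evx_ge0 q : val_ge nu 0 x0 -> val_ge nu 0 (evx j x0 q).
Proof. exact: val_ge_horner. Qed.

Lemma evx_near c q : val_ge nu 1 (x0 - j c) -> val_ge nu 1 (evx j x0 q - j q.[c]).
Proof.
move=> x0c; have /factor_theorem[q1 qE] : root (q - q.[c]%:P) c.
  by rewrite rootE !hornerE subrr.
have -> : evx j x0 q - j q.[c] = evx j x0 q1 * (x0 - j c).
  by rewrite -(evx_const j x0) -rmorphB qE rmorphM rmorphB evx_X evx_const.
rewrite -[1]add0r (val_geM nuP) // evx_ge0 //.
rewrite -(subrK (j c) x0) (val_geD nuP) ?(val_ge_const nuP) //.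
exact: val_geW x0c.
Qed.

Lemma evx_pole q : nu x0 < 0 -> q != 0 ->
  evx j x0 q != 0 /\ nu (evx j x0 q) = nu x0 *+ (size q).-1.
Proof.
move=> x0_pole.
have x00 : x0 != 0.
  by apply: contraTneq x0_pole => ->; rewrite -(rmorph0 j) (int_val_const nuP).
elim/poly_ind: q => [|q c IH]; first by rewrite eqxx.
have [->|q0] := eqVneq q 0.
  rewrite mul0r add0r polyC_eq0 => c0.
  by rewrite evx_const fmorph_eq0 c0 (int_val_const nuP) size_polyC c0.
move=> _; have [q10 q1e] := IH q0.
rewrite size_MXaddC (negbTE q0) rmorphD rmorphM evx_X evx_const -pred_Sn.
have qx : nu (evx j x0 q * x0) = nu x0 *+ size q.
  by rewrite (int_valM nuP) // q1e addrC -mulrS prednK // size_poly_gt0.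
rewrite -qx; apply: (val_dominant nuP); first by rewrite mulf_neq0.
apply: val_geW (val_ge_const nuP c); rewrite qx.
by have := size_poly_gt0 q; rewrite q0; case: (size q) => // d _; lia.
Qed.

End OrdersOfPolynomials.

Section RegularForm.
Variables (k : closedFieldType) (K : fieldType) (iota : {rmorphism k -> K}).
Variables (u m n : nat) (x y : K).
Hypothesis k2 : 2%N \in [pchar k].
Hypotheses (u_gt0 : (0 < u)%N) (m_dvd : (m %| 2 ^ u + 1)%N) (n_gt0 : (0 < n)%N).
Notation ev := (ev iota x y).
Hypothesis ev_eq0 : forall Q, ev Q = 0 <-> exists S, Q = S * F_equation k m n.
Hypothesis ev_frac : forall z, exists A B, ev B != 0 /\ z = ev A / ev B.
Variables (f a b : K) (A : {poly {poly k}}) (R : {poly k}).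
Hypotheses (f_even : even_at_places iota f) (fE : f = a ^+ 2 + b ^+ 2 * x).
Hypotheses (f0 : f != 0) (b0 : b != 0) (R0 : R != 0) (Am : (size A <= m)%N).
Hypothesis wE : b ^+ 2 / f * y ^+ m.-1 * evx iota x R = ev A.

Let m_odd : odd m := odd_dvd_pow2_add1 u_gt0 m_dvd.
Let m_gt0 : (0 < m)%N := odd_gt0 m_odd.

Lemma coef_lt_degree l : A`_l != 0 -> (l < m)%N.
Proof. by rewrite ltnNge; apply: contraNN => ml; rewrite nth_default // (leq_trans Am). Qed.

(** At the places above $x = c$ the expansion is $x = c + t^m$,
    $y = \rho t^s V^{1/m}$, with $s$ the multiplicity of $c$ as a root of
    $x^n + 1$. There a root of the denominator has order at least $m$ in $t$, a
    larger pole than holomorphy of the form leaves to a coefficient that does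
    not vanish at $c$. *)
Lemma regular_at_finite_places c l : root R c -> root A`_l c.
Proof.
move=> Rc; apply/negPn/negP => Alc.
have Al0 : A`_l != 0 by apply: contraNneq Alc => ->; rewrite root0.
have lm := coef_lt_degree Al0.
have [F [j [nu [nuP [t t0 nut]]]]] := exists_valued_field k.
pose x0 := j c + t ^+ m.
have x0c : x0 - j c = t ^+ m by rewrite /x0 addrC addKr.
have nux0c : nu (x0 - j c) = m%:Z by rewrite x0c (int_valX nuP) // nut natz.
have x0_near : val_ge nu 1 (x0 - j c) by rewrite /val_ge nux0c lez_nat m_gt0 orbT.
have x0_odd : ~~ (2 %| nu (x0 - j c))%Z by rewrite nux0c dvdzE /= dvdn2 m_odd.
have [s [G /implyP Gc XnE]] := multiplicity_XsubC ('X^n + 1 : {poly k}) c.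
have {Gc} Gc : G.[c] != 0 by apply: Gc; rewrite -size_poly_gt0 size_XnaddC.
have [rho rhoE] := exists_nth_root G.[c] m_gt0.
have rho0 : rho != 0 by apply: contraNneq Gc => rho0; rewrite -rhoE rho0 expr0n gtn_eqF.
pose beta := j rho * t ^+ s; pose V := evx j x0 G / j G.[c].
have beta0 : beta != 0 by rewrite mulf_neq0 ?fmorph_eq0 // expf_neq0.
have nubeta : nu beta = s%:Z.
  by rewrite (int_valM nuP) ?fmorph_eq0 ?expf_neq0 // (int_val_const nuP) (int_valX nuP) // nut add0r natz.
have jGc : j G.[c] != 0 by rewrite fmorph_eq0.
have V1 : val_ge nu 1 (V - 1).
  have -> : V - 1 = (evx j x0 G - j G.[c]) * j (G.[c])^-1.
    by rewrite mulrBl fmorphV divff.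
  by rewrite -[1]addr0 (val_geM nuP) ?(val_ge_const nuP) // (evx_near nuP).
have x0_pow : x0 ^+ n + 1 = beta ^+ m * V.
  have -> : x0 ^+ n + 1 = evx j x0 ('X^n + 1) by rewrite rmorphD rmorphXn rmorph1 evx_X.
  rewrite XnE rmorphM rmorphXn rmorphB evx_X evx_const x0c /beta /V exprMn -rmorphXn rhoE.
  by rewrite exprAC [RHS]mulrACA mulrC; field.
have := coefficient_bound k2 u_gt0 m_dvd n_gt0 ev_eq0 ev_frac nuP x0_odd beta0 V1
  x0_pow f_even fE f0 b0 R0 Am wE lm Al0.
have [R1 RE] := factor_theorem _ _ Rc.
have nuR : m%:Z <= nu (evx j x0 R).
  have Rx0 := local_transcendental nuP x0_odd R0.
  have : val_ge nu (0 + m%:Z) (evx j x0 R).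
    rewrite RE rmorphM rmorphB evx_X evx_const -nux0c (val_geM nuP) ?val_ge_refl //.
    rewrite (evx_ge0 nuP) // /x0 (val_geD nuP) ?(val_ge_const nuP) //.
    by rewrite -x0c; apply: val_geW x0_near.
  by rewrite add0r /val_ge (negbTE Rx0).
have nuA : nu (evx j x0 A`_l) = 0.
  have jA : j (A`_l).[c] != 0 by rewrite fmorph_eq0.
  have [|_ ->] := val_close nuP jA (g := evx j x0 A`_l); last exact: int_val_const nuP _.
  by rewrite (int_val_const nuP) add0r (evx_near nuP).
rewrite nuA nux0c nubeta -[_ *+ m.-1]mulr_natr -[_ *+ l]mulr_natr !natz add0r.
by move: nuR m_gt0 lm; clear; move: (nu _) => r; nia.
Qed.

(** Holomorphy at infinity, where $x = t^{-m}$ and $y = t^{-n} (1 + t^{mn})^{1/m}$,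
    so that the order in $t$ of a coefficient is $-m$ times its degree in $x$. *)
Lemma degree_bound l : size R = 1%N -> A`_l != 0 ->
  (m * size (A`_l)%R < n * (m.-1 - l))%N.
Proof.
move=> R1 Al0; have lm := coef_lt_degree Al0.
have [F [j [nu [nuP [t t0 nut]]]]] := exists_valued_field k.
pose x0 := t^-1 ^+ m; pose beta := t^-1 ^+ n; pose V := 1 + t ^+ (m * n).
have tV0 : t^-1 != 0 by rewrite invr_eq0.
have nux0 : nu x0 = - m%:Z by rewrite (int_valX nuP) // (int_valV nuP) // nut mulNrn natz.
have nubeta : nu beta = - n%:Z by rewrite (int_valX nuP) // (int_valV nuP) // nut mulNrn natz.
(* At infinity the constant subtracted from $x$ is irrelevant; $0$ serves. *)
have x0_odd : ~~ (2 %| nu (x0 - j 0%R))%Z by rewrite rmorph0 subr0 nux0 dvdzE abszN /= dvdn2 m_odd.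
have V1 : val_ge nu 1 (V - 1).
  rewrite /V addrC addKr /val_ge (int_valX nuP) // nut natz lez_nat muln_gt0.
  by rewrite m_gt0 n_gt0 orbT.
have x0_pow : x0 ^+ n + 1 = beta ^+ m * V.
  rewrite /x0 /beta /V mulrDr mulr1 -!exprM [(n * m)%N]mulnC -exprMn mulVf //.
  by rewrite expr1n.
have beta0 : beta != 0 by rewrite expf_neq0.
have := coefficient_bound k2 u_gt0 m_dvd n_gt0 ev_eq0 ev_frac nuP x0_odd beta0 V1
  x0_pow f_even fE f0 b0 R0 Am wE lm Al0.
have x0_pole : nu x0 < 0 by rewrite nux0 oppr_lt0 ltz_nat.
rewrite rmorph0 subr0 nux0 nubeta (evx_pole nuP x0_pole R0).2 R1 mulr0n.
rewrite (evx_pole nuP x0_pole Al0).2 nux0.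
rewrite -[_ *+ m.-1]mulr_natr -[_ *+ l]mulr_natr -[_ *+ (size _).-1]mulr_natr !natz.
move: Al0 m_gt0 lm; rewrite -size_poly_gt0; clear.
by case: (size A`_l) => // d _; case: m => // m'; rewrite -!pred_Sn; nia.
Qed.

End RegularForm.

(** The forms $x^i y^l dx / y^{m-1}$ satisfying these inequalities are the usual basis
    of the holomorphic differentials. *)
Lemma regular_form (k : closedFieldType) (K : fieldType) (iota : {rmorphism k -> K})
    (u m n : nat) (x y f a b : K) :
    2%N \in [pchar k] -> (0 < u)%N -> (m %| 2 ^ u + 1)%N -> (0 < n)%N ->
    (forall Q, ev iota x y Q = 0 <-> exists S, Q = S * F_equation k m n) ->
    (forall z, exists A B, ev iota x y B != 0 /\ z = ev iota x y A / ev iota x y B) ->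
    even_at_places iota f -> f = a ^+ 2 + b ^+ 2 * x -> f != 0 -> b != 0 ->
  exists g : {poly {poly k}}, ev iota x y g = b ^+ 2 / f * y ^+ m.-1 /\
    forall l i, (g`_l)`_i != 0 -> (m * i.+1 < n * (m.-1 - l))%N.
Proof.
move=> k2 u_gt0 m_dvd n_gt0 ev_eq0 ev_frac f_even fE f0 b0.
have m_gt0 : (0 < m)%N := odd_gt0 (odd_dvd_pow2_add1 u_gt0 m_dvd).
have [A [R [Am R0 wE red]]] :=
  reduced_fraction m_gt0 ev_eq0 ev_frac (b ^+ 2 / f * y ^+ m.-1).
have R1 : size R = 1%N.
  apply/eqP/negPn/negP => /closed_rootP[c Rc]; have [l] := red c Rc.
  by rewrite (regular_at_finite_places k2 u_gt0 m_dvd n_gt0 ev_eq0 ev_frac f_even fE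
               f0 b0 R0 Am wE l Rc).
have [r r0 RE] : exists2 r, r != 0 & R = r%:P.
  by move/eqP/size_poly1P: R1 => [r r0 ->]; exists r.
have rV : evx iota x (r^-1)%:P * evx iota x R = 1.
  by rewrite -rmorphM RE -polyCM mulVf // rmorph1.
exists ((r^-1)%:P *: A); split.
  by rewrite ev_scale -wE mulrCA rV mulr1.
move=> l i; rewrite coefZ coefCM mulf_eq0 negb_or => /andP[_ Ali].
have Al0 : A`_l != 0 by apply: contraNneq Ali => ->; rewrite coef0.
apply: leq_ltn_trans (degree_bound k2 u_gt0 m_dvd n_gt0 ev_eq0 ev_frac f_even fE
  f0 b0 R0 Am wE R1 Al0).
rewrite leq_mul2l; apply/orP; right; rewrite ltnNge.
by apply: contraNN Ali => Ai; rewrite nth_default.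
Qed.

(** * Doubling of exponents *)

Lemma modn_eq_small n a b : (a < n)%N -> (b < n)%N -> a = b %[mod n] -> a = b.
Proof. by move=> an bn; rewrite !modn_small. Qed.

(** Let $L = \mathrm{lcm}(u, v)$. Then $2^L$ is $1$ modulo $n$ and, $L$ being an
    odd multiple of $u$, it is $-1$ modulo $m$. So doubling $L$ times leads from
    $(I, J)$ to $(I, m - J)$, and the sum of the inequalities at these two points
    is $2I < n$. Thus $I$ is doubled as an integer at each step, without bound. *)
Lemma doubling_escapes u v m n (S : nat -> nat -> Prop) :
    odd (v %/ gcdn u v) ->
    (m %| 2 ^ u + 1)%N -> (n %| 2 ^ v - 1)%N ->
    (forall I J, S I J -> [/\ (0 < I)%N, (0 < J)%N & (m * I + n * J < m * n)%N]) ->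
    (forall I J, S I J ->
       exists I1 J1, [/\ S I1 J1, I1 = 2 * I %[mod n] & J1 = 2 * J %[mod m]]) ->
  forall I J, ~ S I J.
Proof.
move=> uv_odd m_dvd n_dvd S_bd S_dbl.
pose L := (u * (v %/ gcdn u v))%N.
have LE : L = (v * (u %/ gcdn u v))%N.
  by rewrite /L mulnC divn_mulAC ?dvdn_gcdr // muln_divA ?dvdn_gcdl.
have nL : (n %| 2 ^ L - 1)%N.
  apply: dvdn_trans n_dvd _; rewrite LE expnM.
  by rewrite !subn1 (predn_exp (2 ^ v)) dvdn_mulr.
have mL : (m %| 2 ^ L + 1)%N.
  by apply: dvdn_trans m_dvd _; rewrite /L expnM dvdn_odd_power_add1.
have bounds I J : S I J -> (I < n)%N /\ (J < m)%N.
  by move=> /S_bd[]; clear; nia.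
have S_pow t I J : S I J ->
    exists I1 J1, [/\ S I1 J1, I1 = 2 ^ t * I %[mod n] & J1 = 2 ^ t * J %[mod m]].
  move=> SIJ; elim: t => [|t [I1 [J1 [SIJ1 I1E J1E]]]]; first by exists I, J; rewrite !mul1n.
  have [I2 [J2 [SIJ2 I2E J2E]]] := S_dbl _ _ SIJ1; exists I2, J2; split=> //.
    by rewrite I2E expnS -mulnA -modnMmr I1E modnMmr.
  by rewrite J2E expnS -mulnA -modnMmr J1E modnMmr.
have half I J : S I J -> (2 * I < n)%N.
  move=> SIJ; have [In Jm] := bounds _ _ SIJ.
  have [I1 [J1 [SIJ1 I1E J1E]]] := S_pow L _ _ SIJ.
  have [I1n J1m] := bounds _ _ SIJ1.
  have {I1E} I1E : I1 = I.
    apply: (modn_eq_small I1n In); rewrite I1E; apply/eqP.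
    rewrite eqn_mod_dvd; last by rewrite leq_pmull // expn_gt0.
    by rewrite -[X in (_ - X)%N]mul1n -mulnBl dvdn_mulr.
  have {J1E} : (m %| J1 + J)%N.
    rewrite /dvdn -modnDml J1E modnDml -[X in (_ + X)%N]mul1n -mulnDl.
    by rewrite -/(dvdn m _) dvdn_mulr.
  have [_ J_gt0 _] := S_bd _ _ SIJ; move/dvdnP => [q qE].
  have {q qE} JE : (J1 + J = m)%N.
    by move: J1m Jm J_gt0 qE; clear; case: q => [|[|q]]; nia.
  have [_ _ bd] := S_bd _ _ SIJ; have [_ _] := S_bd _ _ SIJ1.
  by move: bd; rewrite I1E -JE; clear; nia.
suff main e : forall I J, (n - I < e)%N -> ~ S I J.
  by move=> I J; apply: (main (n - I).+1).
elim: e => [//|e IH] I J Ie SIJ; have IJ2 := half _ _ SIJ.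
have [I1 [J1 [SIJ1 I1E _]]] := S_dbl _ _ SIJ.
have [I1n _] := bounds _ _ SIJ1; have [I_gt0 _ _] := S_bd _ _ SIJ.
have I1E' := modn_eq_small I1n IJ2 I1E.
apply: (IH I1 J1) => //; rewrite I1E'.
by move: Ie IJ2 I_gt0; clear; lia.
Qed.

(** * The Cartier operator *)

Lemma sqr_poly_pchar2 (k : fieldType) (k2 : 2%N \in [pchar k]) (q : {poly k}) :
  q ^+ 2 = map_poly (pFrobenius_aut k2) q \Po 'X^2.
Proof.
elim/poly_ind: q => [|q c IH]; first by rewrite rmorph0 comp_poly0 expr0n.
rewrite sqrrD_pchar2 ?pchar_poly // exprMn IH rmorphD rmorphM /= map_polyX map_polyC.
by rewrite comp_polyD comp_polyM comp_polyX comp_polyC /= pFrobenius_autE polyC_exp.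
Qed.

Lemma poly_square_parts (k : closedFieldType) (p : {poly k}) : 2%N \in [pchar k] ->
  exists E O : {poly k}, p = E ^+ 2 + 'X * O ^+ 2 /\ forall i, E`_i ^+ 2 = p`_(2 * i).
Proof.
move=> k2; have /choice[s sE] (c : k) := exists_nth_root c (isT : 0 < 2)%N.
have s0 : s 0 = 0 by apply/eqP; rewrite -sqrf_eq0 sE.
have sK q : map_poly (pFrobenius_aut k2) (map_poly s q) = q.
  by apply/polyP => i; rewrite coef_map /= coef_map_id0 // pFrobenius_autE sE.
exists (map_poly s (even_poly p)), (map_poly s (odd_poly p)); split.
  by rewrite !(sqr_poly_pchar2 k2 (map_poly s _)) !sK mulrC poly_even_odd.
by move=> i; rewrite coef_map_id0 // sE coef_even_poly mul2n.
Qed.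

Lemma sum_sqr_pchar2 (R : comNzRingType) m (F : 'I_m -> R) : 2%N \in [pchar R] ->
  \sum_(i < m) F i ^+ 2 = (\sum_(i < m) F i) ^+ 2.
Proof.
move=> R2; apply/esym; apply: (big_morph (fun a : R => a ^+ 2)) => [a b|].
  exact: sqrrD_pchar2.
by rewrite expr0n.
Qed.

Section Cartier.
Variables (k : closedFieldType) (K : fieldType) (iota : {rmorphism k -> K}).
Variables (m n : nat) (x y : K).
Hypothesis k2 : 2%N \in [pchar k].
Hypothesis m_odd : odd m.
Notation ev := (ev iota x y).
Notation evx := (evx iota x).
Hypothesis ev_eq0 : forall Q, ev Q = 0 <-> exists S, Q = S * F_equation k m n.
Hypothesis ev_frac : forall z, exists A B, ev B != 0 /\ z = ev A / ev B.

Let m_gt0 : (0 < m)%N := odd_gt0 m_odd.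
Let K2 : 2%N \in [pchar K] := rmorph_pchar iota k2.
Let yE : y ^+ m = x ^+ n + 1 := y_pow ev_eq0.

(** A subfield of $K$ in characteristic $2$, which turns out to be all of $K$. *)
Definition square_plus (z : K) := exists a b, z = a ^+ 2 + b ^+ 2 * x.

Lemma square_plusD z1 z2 : square_plus z1 -> square_plus z2 -> square_plus (z1 + z2).
Proof.
move=> [a1 [b1 ->]] [a2 [b2 ->]]; exists (a1 + a2), (b1 + b2).
by rewrite !sqrrD_pchar2 //; ring.
Qed.

Lemma square_plusM z1 z2 : square_plus z1 -> square_plus z2 -> square_plus (z1 * z2).
Proof.
move=> [a1 [b1 ->]] [a2 [b2 ->]]; exists (a1 * a2 + b1 * b2 * x), (a1 * b2 + a2 * b1).
by rewrite !sqrrD_pchar2 //; ring.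
Qed.

Lemma square_plus_sqr z : square_plus (z ^+ 2).
Proof. by exists z, 0; rewrite expr0n mul0r addr0. Qed.

Lemma square_plus_const c : square_plus (iota c).
Proof.
have [s <-] := exists_nth_root c (isT : 0 < 2)%N.
by rewrite rmorphXn; apply: square_plus_sqr.
Qed.

Lemma square_plus_x : square_plus x.
Proof. by exists 0, 1; rewrite expr0n expr1n mul1r add0r. Qed.

Lemma square_plus_evx q : square_plus (evx q).
Proof.
elim/poly_ind: q => [|q c IH]; first by rewrite rmorph0 -(rmorph0 iota); apply: square_plus_const.
rewrite rmorphD rmorphM evx_X evx_const.
exact: square_plusD (square_plusM IH square_plus_x) (square_plus_const c).
Qed.

Lemma square_plusV z : square_plus z -> square_plus z^-1.
Proof.
have [->|z0] := eqVneq z 0; first by rewrite invr0.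
move=> zT; have -> : z^-1 = z * z^-1 ^+ 2 by field.
exact: square_plusM zT (square_plus_sqr _).
Qed.

(** As $m$ is odd, $y$ is $y^m$ up to a square. *)
Lemma square_plus_y : square_plus y.
Proof.
have ym : square_plus (y ^+ m).
  rewrite yE; have := square_plus_evx ('X^n + 1).
  by rewrite rmorphD rmorphXn rmorph1 evx_X.
have [y0|y0] := eqVneq y 0.
  by rewrite y0 -(rmorph0 iota); apply: square_plus_const.
have -> : y = (y ^+ uphalf m) ^+ 2 * (y ^+ m)^-1.
  apply: (mulIf (expf_neq0 m y0)); rewrite divfK ?expf_neq0 // -exprS -exprM muln2.
  by congr (_ ^+ _); rewrite -[LHS]odd_double_half /= m_odd uphalfE.
exact: square_plusM (square_plus_sqr _) (square_plusV ym).
Qed.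

Lemma square_plus_all z : square_plus z.
Proof.
have ev_sp Q : square_plus (ev Q).
  elim/poly_ind: Q => [|Q q IH]; first by rewrite rmorph0 -(rmorph0 iota); apply: square_plus_const.
  rewrite rmorphD rmorphM ev_Y ev_const.
  exact: square_plusD (square_plusM IH square_plus_y) (square_plus_evx q).
have [A [B [_ ->]]] := ev_frac z.
exact: square_plusM (ev_sp A) (square_plusV (ev_sp B)).
Qed.

Hypothesis x_nonsquare : forall z, z ^+ 2 != x.

(** A nonsquare $x$ is linearly independent from $1$ over $K^2$. *)
Lemma square_parts_uniq a b a' b' :
  a ^+ 2 + x * b ^+ 2 = a' ^+ 2 + x * b' ^+ 2 -> a = a'.
Proof.
move=> abE; have : (a - a') ^+ 2 = x * (b' - b) ^+ 2.
  rewrite !oppr_pchar2 // !sqrrD_pchar2 //.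
  apply/eqP; rewrite -subr_eq0 oppr_pchar2 // mulrDr.
  rewrite -[X in X == _](_ : (a ^+ 2 + x * b ^+ 2) + (a' ^+ 2 + x * b' ^+ 2) = _); last by ring.
  by rewrite abE addrr_pchar2.
have [->|bb] := eqVneq (b' - b) 0.
  by rewrite expr0n mulr0 => /eqP; rewrite sqrf_eq0 subr_eq0 => /eqP.
move=> xE; case/negP: (x_nonsquare ((a - a') / (b' - b))).
by rewrite expr_div_n xE mulfK // expf_neq0.
Qed.

(** The hypothesis says that the differential $H\,dx / (x y^m)$ is fixed by the
    Cartier operator. The left side is expanded on the squares $y^{2J}$ with
    coefficients in $k[x]$: for $2J \ge m$ the factor $x^n + 1 = y^m$ is absorbed
    into $y^{2J}$. Splitting each coefficient as $E^2 + x O^2$ and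
    comparing the parts in $K^2$ gives the result. *)
Lemma fixed_form_coef (H : {poly {poly k}}) s : (size H <= m)%N ->
    ev H * (x ^+ n + 1) = ev H ^+ 2 + x * s ^+ 2 ->
  forall I J, (J < m)%N -> (H`_J)`_I ^+ 2 =
    (if (2 * J < m)%N then H`_(2 * J) * ('X^n + 1) else H`_(2 * J - m))`_(2 * I).
Proof.
move=> Hm HE I J Jm.
pose C J := if (2 * J < m)%N then H`_(2 * J) * ('X^n + 1) else H`_(2 * J - m).
have /choice[E /choice[O EO]] j := poly_square_parts (C j) k2.
have dbl_lt (j : 'I_m) : ((2 * j) %% m < m)%N by rewrite ltn_mod.
pose dbl j := Ordinal (dbl_lt j).
have dblE (j : 'I_m) : dbl j = (if (2 * j < m)%N then 2 * j else 2 * j - m)%N :> nat.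
  rewrite /=; case: ltnP => j2; first by rewrite modn_small.
  rewrite -[in LHS](subnK j2) modnDr modn_small //.
  by move: (ltn_ord j) j2; clear; lia.
have dbl_inj : injective dbl.
  move=> i j /(congr1 (@nat_of_ord m)); rewrite !dblE => ij; apply: val_inj => /=; move: ij.
  have mE : (1 + 2 * m./2 = m)%N by rewrite -[RHS]odd_double_half m_odd mul2n.
  move: (ltn_ord i) (ltn_ord j) mE; clear.
  by case: (ltnP (2 * i) m) => i2; case: (ltnP (2 * j) m) => j2; lia.
have CE : ev H * (x ^+ n + 1) = \sum_(j < m) evx (C j) * (y ^+ j) ^+ 2.
  rewrite (ev_sum _ _ _ Hm) mulr_suml (reindex_inj dbl_inj); apply: eq_bigr => j _.
  rewrite dblE /C -exprM [(j * 2)%N]mulnC; case: ltnP => j2.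
    by rewrite rmorphM rmorphD rmorphXn rmorph1 evx_X mulrAC.
  by rewrite -[in RHS](subnK j2) exprD yE addnK mulrA.
pose EE := \poly_(j < m) E j.
have EEm : (size EE <= m)%N by rewrite size_poly.
have evEE : ev EE = \sum_(j < m) evx (E j) * y ^+ j.
  by rewrite (ev_sum _ _ _ EEm); apply: eq_bigr => j _; rewrite coef_poly ltn_ord.
have : ev EE ^+ 2 + x * (\sum_(j < m) evx (O j) * y ^+ j) ^+ 2 = ev H ^+ 2 + x * s ^+ 2.
  rewrite -HE CE evEE -!sum_sqr_pchar2 // mulr_sumr -big_split; apply: eq_bigr => j _.
  rewrite -[LHS]/((evx (E j) * y ^+ j) ^+ 2 + x * (evx (O j) * y ^+ j) ^+ 2).
  by rewrite (EO j).1 rmorphD rmorphXn [evx ('X * _)]rmorphM evx_X rmorphXn; ring.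
move=> /square_parts_uniq EH.
have {EH} EH : EE = H.
  apply/eqP; rewrite -subr_eq0; apply/eqP; apply: (ev_inj_small m_gt0 ev_eq0).
    by rewrite (leq_trans (size_polyD _ _)) // size_polyN geq_max EEm.
  by rewrite rmorphB EH subrr.
by rewrite -EH coef_poly Jm (EO J).2 EH.
Qed.

End Cartier.

(** * Functions of even order and torsion of order two *)

Lemma even_at_places_square (k : closedFieldType) (K : fieldType)
    (iota : {rmorphism k -> K}) (u v m n : nat) (x y f : K) :
    2%N \in [pchar k] -> (0 < u)%N -> (0 < n)%N ->
    (m %| 2 ^ u + 1)%N -> (n %| 2 ^ v - 1)%N -> odd (v %/ gcdn u v) ->
    (forall Q, ev iota x y Q = 0 <-> exists S, Q = S * F_equation k m n) ->
    (forall z, exists A B, ev iota x y B != 0 /\ z = ev iota x y A / ev iota x y B) ->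
    f != 0 -> even_at_places iota f -> exists a, f = a ^+ 2.
Proof.
move=> k2 u_gt0 n_gt0 m_dvd n_dvd uv_odd ev_eq0 ev_frac f0 f_even.
have m_odd := odd_dvd_pow2_add1 u_gt0 m_dvd; have m_gt0 := odd_gt0 m_odd.
have K2 : 2%N \in [pchar K] := rmorph_pchar iota k2.
have [a [b fE]] := square_plus_all k2 m_odd ev_eq0 ev_frac f.
(* If $x$ were a square, so would be every $a^2 + b^2 x$. *)
have [[z zE]|x_ns] := pselect (exists z, z ^+ 2 = x).
  by exists (a + b * z); rewrite sqrrD_pchar2 // exprMn zE.
have {}x_ns z : z ^+ 2 != x by apply/eqP => zE; apply: x_ns; exists z.
have [b0|b0] := eqVneq b 0; first by exists a; rewrite fE b0 expr0n mul0r addr0.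
exfalso.
have [g [gE g_bd]] := regular_form k2 u_gt0 m_dvd n_gt0 ev_eq0 ev_frac f_even fE f0 b0.
have y0 := y_neq0 u_gt0 m_dvd n_gt0 ev_eq0.
(* The shift by $xy$ turns the bounds on the exponents into conditions on residues
   modulo $n$ and $m$. *)
pose H : {poly {poly k}} := ('X)%:P * (g * 'X).
have coefH I J : (H`_J)`_I != 0 -> exists I' J', [/\ I = I'.+1, J = J'.+1 & (g`_J')`_I' != 0].
  rewrite /H coefCM coefMX; case: J => [|J] /=; first by rewrite mulr0 coef0 eqxx.
  by rewrite coefXM; case: I => [|I] /=; rewrite ?eqxx // => gIJ; exists I, J.
have H_bd I J : (H`_J)`_I != 0 -> [/\ (0 < I)%N, (0 < J)%N & (m * I + n * J < m * n)%N].
  move=> /coefH[I' [J' [-> -> /g_bd bd]]]; split=> //.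
  by move: bd m_gt0; clear; case: m => // m' + _; rewrite -pred_Sn; nia.
have ev_H : ev iota x y H = x * (b ^+ 2 / f * y ^+ m).
  have ym : y ^+ m = y ^+ m.-1 * y by rewrite -exprSr prednK.
  by rewrite /H !rmorphM ev_const evx_X ev_Y gE ym; ring.
have H_fixed : ev iota x y H * (x ^+ n + 1) =
    ev iota x y H ^+ 2 + x * (a * b * y ^+ m / f) ^+ 2.
  by rewrite -(y_pow ev_eq0) ev_H fE; field; rewrite -fE.
have Hm : (size H <= m)%N.
  apply/leq_sizeP => J mJ; apply/polyP => I; rewrite coef0; apply/eqP.
  apply: contraT => /H_bd[I_gt0 _]; move: mJ I_gt0 n_gt0.
  by clear; nia.
have H_dbl I J : (H`_J)`_I != 0 -> exists I1 J1,
    [/\ (H`_J1)`_I1 != 0, I1 = 2 * I %[mod n] & J1 = 2 * J %[mod m]].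
  move=> HIJ; have [I_gt0 J_gt0 bd] := H_bd _ _ HIJ.
  have Jm : (J < m)%N by move: bd I_gt0; clear; nia.
  have := fixed_form_coef k2 m_odd ev_eq0 x_ns Hm H_fixed I Jm.
  have HIJ2 : (H`_J)`_I ^+ 2 != 0 by rewrite expf_neq0.
  case: ltnP => J2 => [|HE]; last first.
    exists (2 * I)%N, (2 * J - m)%N; rewrite -HE; split=> //.
    by rewrite -[in RHS](subnK J2) modnDr.
  rewrite mulrDr mulr1 coefD coefMXn; case: ifP => I2 HE.
    rewrite add0r in HE; exists (2 * I)%N, (2 * J)%N; rewrite -HE.
    by split.
  have [H0|H0] := eqVneq (H`_(2 * J))`_(2 * I) 0.
    exists (2 * I - n)%N, (2 * J)%N; split=> //.
      by move: HIJ2; rewrite HE H0 addr0.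
    by rewrite -[in RHS](@subnK n (2 * I)) ?modnDr // leqNgt I2.
  by exists (2 * I)%N, (2 * J)%N; split.
have H0 : H = 0.
  apply/polyP => J; rewrite coef0; apply/polyP => I; rewrite coef0; apply/eqP/negPn/negP.
  exact: (doubling_escapes uv_odd m_dvd n_dvd H_bd H_dbl).
have : ev iota x y H != 0.
  have x0 : x != 0 by rewrite -(evx_X iota x) (evx_eq0 m_gt0 ev_eq0) polyX_eq0.
  by rewrite ev_H !mulf_neq0 ?invr_eq0 // expf_neq0.
by rewrite H0 rmorph0 eqxx.
Qed.

(** Triviality of the $2$-torsion: if $2D$ is the divisor of $f$, then $f$ has even
    order everywhere, so that $f = a^2$ and $D$ is the divisor of $a$. *)
Lemma trivial_two_torsion (k K : fieldType) (iota : {rmorphism k -> K}) :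
  (forall f, f != 0 -> even_at_places iota f -> exists a, f = a ^+ 2) ->
  has_p_rank iota 2 0.
Proof.
move=> even_sqr; exists (\0 : {additive 'rV['F_2]_0 -> jacobian iota}).
split; first by move=> v w _; rewrite [v]thinmx0 [w]thinmx0.
elim/quotW => D; split; last first.
  by case=> v <-; rewrite mul0rn.
move=> D2; exists 0.
have {D2} : D + D \in principal (iota := iota).
  rewrite -[D + D]subr0 Quotient.idealrBE.
  by move/eqP: D2; rewrite mulr2n !piE.
move=> /asboolP[f [f0 fD]].
have f_ord (P : place iota) : ord P f = coeff P D *+ 2.
  by rewrite -fD mulr2n; exact: coeffD.
have [a fE] : exists a, f = a ^+ 2.
  apply: even_sqr => // w wP.
  have -> : w f = coeff (Place wP) D *+ 2 := f_ord (Place wP).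
  by apply/dvdzP; exists (coeff (Place wP) D); ring.
have a0 : a != 0 by move: f0; rewrite fE expf_eq0.
have : D \in principal (iota := iota).
  apply/asboolP; exists a; split=> // P.
  have := f_ord P; rewrite fE (int_valX (valuation_int_valuation (ordP P))) //.
  by move=> /eqP; rewrite -subr_eq0 -mulrnBl mulrn_eq0 /= subr_eq0 => /eqP.
rewrite -{1}[D]subr0 Quotient.idealrBE => /eqP piD; rewrite piD.
by rewrite -[LHS]/(0 : jacobian iota) piE.
Qed.

Theorem corollary4p10 (u v m n : nat)
  (u_gt0 : (0 < u)%N) (v_gt0 : (0 < v)%N) (m_gt0 : (0 < m)%N) (n_gt0 : (0 < n)%N)
  (m_dvd : (m %| 2 ^ u + 1)%N) (n_dvd : (n %| 2 ^ v - 1)%N)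
  (uv_odd : odd (v %/ gcdn u v))
  (* k is an algebraic closure of F_2 *)
  (k : closedFieldType) (F2_to_k : {rmorphism 'F_2 -> k})
  (k_alg : integralRange F2_to_k)
  (* K / k is the function field of the curve y^m = x^n + 1 *)
  (K : fieldType) (iota : {rmorphism k -> K})
  (K_curve : is_function_field iota (F_equation k m n)) :
  has_p_rank iota 2 0.
Proof.
have k2 : 2%N \in [pchar k] := rmorph_pchar F2_to_k (pchar_Fp (isT : prime 2)).
case: K_curve => x [y [ev_eq0 ev_frac]].
apply: trivial_two_torsion => f.
exact: (even_at_places_square k2 u_gt0 n_gt0 m_dvd n_dvd uv_odd ev_eq0 ev_frac).
Qed.
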